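(* Let $k>0$, $b_0\le 0$ and $c,m\in\mathbb{R}$, let $\Sigma:=\mathbb{R}\times(-\infty,b_0)$, and for $t\ge 0$, $a\in\mathbb{R}$, $b\le b_0$ put $$X(t,a,b):=a+(c-m)t-\frac{e^{kb}}{k}\sin(k(a-mt)),\qquad Z(t,a,b):=b+\frac{e^{kb}}{k}\cos(k(a-mt)).$$ For each $t\ge 0$ the map $\Phi(t):=(X(t,\cdot,\cdot),Z(t,\cdot,\cdot))$ is a real-analytic diffeomorphism from $\Sigma$ onto its image $\Omega(t):=\Phi(t)(\Sigma)$. Moreover, there exists a function $\eta:\mathbb{R}\to\mathbb{R}$ (independent of $t$), periodic with minimal period $2\pi/k$, such that for all $t\ge 0$ $$\Omega(t)=\{(X,Z)\,:\,X\in\mathbb{R}\text{ and }Z<\eta(t,X):=\eta(X-ct)\},$$ and $\Phi(t):\partial\Sigma\to\partial\Omega(t)$ is a bijective map.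
   Context: The boundary of $\Sigma$ is $\partial\Sigma=\mathbb{R}\times\{b_0\}$, and $\Phi(t)$ is evaluated there by the same formulas (which make sense for $b\le b_0$). *)

(* Defs.v *)
From mathcomp Require Import all_boot all_order all_algebra.
From mathcomp Require Import all_classical all_reals all_analysis.

Set Implicit Arguments.
Unset Strict Implicit.
Unset Printing Implicit Defensive.
Import Order.TTheory GRing.Theory Num.Theory.
Import numFieldNormedType.Exports.

Local Open Scope classical_set_scope.
Local Open Scope ring_scope.

(* Near p, f is the sum of an absolutely convergent double power series in the
   increments (h, l). Because of the absolute convergence the order of
   summation is immaterial; the value is read off the square partial sums. *)
Definition real_analytic_at (R : realType) (f : R * R -> R) (p : R * R) : Prop :=
  exists a : nat -> nat -> R, exists2 r : R, 0 < r &
    forall h l : R, `|h| < r -> `|l| < r ->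
      summable [set: nat * nat]
        (fun n => (a n.1 n.2 * h ^+ n.1 * l ^+ n.2)%:E) /\
      (fun N : nat => \sum_(i < N) \sum_(j < N) a i j * h ^+ i * l ^+ j) @ \oo
        --> f (p.1 + h, p.2 + l).

Definition real_analytic_on (R : realType) (U : set (R * R))
    (F : R * R -> R * R) : Prop :=
  forall p, U p -> real_analytic_at (fun q => (F q).1) p /\
                   real_analytic_at (fun q => (F q).2) p.

(* The values of F outside U, and of G outside V, play no role: U and V are
   open and real_analytic_at is a local property. *)
Definition real_analytic_diffeo (R : realType) (U V : set (R * R))
    (F : R * R -> R * R) : Prop :=
  [/\ open U, open V, set_bij U V F, real_analytic_on U F &
      exists2 G : R * R -> R * R,
        (forall p, U p -> G (F p) = p) & real_analytic_on V G].

Definition boundary (T : topologicalType) (A : set T) : set T :=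
  closure A `\` interior A.

Definition minimal_period (R : realType) (f : R -> R) (T : R) : Prop :=
  [/\ 0 < T, periodic f T &
      forall T' : R, 0 < T' -> periodic f T' -> T <= T'].

Definition Sigma (R : realType) (b0 : R) : set (R * R) := [set p | p.2 < b0].

Definition X (R : realType) (k c m t a b : R) : R :=
  a + (c - m) * t - expR (k * b) / k * sin (k * (a - m * t)).

Definition Z (R : realType) (k m t a b : R) : R :=
  b + expR (k * b) / k * cos (k * (a - m * t)).

Definition Phi (R : realType) (k c m t : R) (p : R * R) : R * R :=
  (X k c m t p.1 p.2, Z k m t p.1 p.2).

Definition Omega (R : realType) (k b0 c m t : R) : set (R * R) :=
  Phi k c m t @` Sigma b0.

(* Main.v *)
(* In the frame moving with the wave, Phi is z |-> z + (i / k) exp (i k conj z)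
   with z = a + i b, and exp is a strict contraction on the closed left half
   plane, so the perturbation of the identity is a strict contraction on b <= 0.
   This gives injectivity, and on a level set {X = const} it makes Z a strictly
   increasing Lipschitz function of b, whence the image is the region below the
   trochoid eta, the image of b = b0.

   For the analyticity of the inverse, write the increments of (a, b) and (X, Z)
   as the complex numbers sigma = k (db + i da) and tau = k (dZ + i dX); then
   sigma = tau - conj (E0 (exp sigma - 1)) with |E0| = exp (k b) < 1. The Picard
   iterates, with exp replaced by its partial sums, are polynomials in the
   increments, and their successive differences are summable in the weighted
   l^1 norm of the coefficients because |E0| exp rho < 1 for small rho. *)

Require Import Defs.
From mathcomp Require Import all_boot all_order all_algebra.
From mathcomp Require Import all_classical all_reals all_analysis.
From mathcomp Require Import complex ring lra.

Set Implicit Arguments.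
Unset Strict Implicit.
Unset Printing Implicit Defensive.
Import Order.TTheory GRing.Theory Num.Theory.
Import numFieldNormedType.Exports.

Local Open Scope classical_set_scope.
Local Open Scope complex_scope.
Local Open Scope ring_scope.

(* The bare names Re and Im denote the numClosedFieldType projections. *)
Local Notation Re := complex.Re.
Local Notation Im := complex.Im.

(** * Strict contraction estimates for the exponential on the closed left half plane *)

Section contraction.
Variable R : realType.
Implicit Types x y d : R.

Lemma sin_lt_id d : 0 < d -> sin d < d.
Proof.
move=> d0; have [d1|d1] := ltP 1 d; first exact: le_lt_trans (sin_le1 d) d1.
have [|c /[!in_itv]/= /andP[c0 cd]] := @MVT R sin cos _ _ d0.
  by apply: continuous_subspaceT => x; exact: continuous_sin.
rewrite sin0 !subr0 => ->; rewrite gtr_pMl// lt_neqAle cos_le1 andbT.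
apply/eqP => c1; have := @sin2_gt0 R c.
rewrite c0 (lt_trans (lt_le_trans cd d1)) ?ltr1n// => /(_ isT).
by rewrite cos1sin0 ?ltxx// c1 normr1.
Qed.

Lemma sin2_lt_sqr d : d != 0 -> sin d ^+ 2 < d ^+ 2.
Proof.
wlog d0 : d / 0 < d.
  move=> H dn0; have [/H/(_ dn0)//|] := ltP 0 d.
  rewrite le_eqVlt (negbTE dn0) /=.
  by rewrite -oppr_gt0 => /H; rewrite oppr_eq0 sinN !sqrrN; apply.
move=> _; have [d1|d1] := ltP 1 d.
  apply: (@le_lt_trans _ _ 1); last by rewrite exprn_egt1.
  by rewrite sin2cos2 gerBl sqr_ge0.
rewrite ltr_sqr ?nnegrE ?ltW//; first exact: sin_lt_id.
by apply: sin2_gt0; rewrite d0 (le_lt_trans d1) ?ltr1n.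
Qed.

(** By the half-angle formula the left side is [4 * sin (d / 2) ^+ 2]. *)
Lemma subr1_cos_lt d : d != 0 -> 2 * (1 - cos d) < d ^+ 2.
Proof.
move=> d0; have -> : d = (d / 2) *+ 2 by rewrite -mulr_natr mulfVK.
have : sin (d / 2) ^+ 2 < (d / 2) ^+ 2.
  by apply: sin2_lt_sqr; rewrite mulf_neq0.
by rewrite sin2cos2 cos_mulr2n => H; lra.
Qed.

(** For [y1 < y2], factor out [expR y2 <= 1] and apply the strict inequality [1 + d < expR d] at
    [d = y1 - y2]. *)
Lemma expR_sub2_lt y1 y2 : y1 <= 0 -> y2 <= 0 -> y1 != y2 ->
  (expR y1 - expR y2) ^+ 2 < (y1 - y2) ^+ 2.
Proof.
wlog y12 : y1 y2 / y1 < y2.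
  move=> H y10 y20 y12; have [/H|] := ltP y1 y2; first exact.
  rewrite le_eqVlt eq_sym (negbTE y12) => /H.
  rewrite eq_sym => /(_ y20 y10 y12).
  by rewrite -[ltRHS]sqrrN -[ltLHS]sqrrN !opprB.
move=> y10 y20 _; rewrite -[ltLHS]sqrrN -[ltRHS]sqrrN !opprB.
rewrite ltr_sqr ?nnegrE ?subr_ge0 ?ler_expR ?ltW//.
have := @expR_gt1Dx R (y1 - y2); rewrite subr_eq0 lt_eqF// => /(_ isT).
have -> : expR y1 = expR y2 * expR (y1 - y2) by rewrite -expRD addrC subrK.
have : expR y2 <= 1 by rewrite expR_le1.
move: (expR_gt0 y2) y12; set E := expR y2; set F := expR (y1 - y2).
by move=> *; nra.
Qed.

Lemma expi_contraction x1 y1 x2 y2 : y1 <= 0 -> y2 <= 0 ->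
  (x1, y1) != (x2, y2) ->
  (expR y1 * cos x1 - expR y2 * cos x2) ^+ 2 +
  (expR y1 * sin x1 - expR y2 * sin x2) ^+ 2 <
  (x1 - x2) ^+ 2 + (y1 - y2) ^+ 2.
Proof.
(* The law of cosines for the polar coordinates (E1, x1) and (E2, x2). *)
move=> y10 y20 x12; set E1 := expR y1; set E2 := expR y2.
have -> : (E1 * cos x1 - E2 * cos x2) ^+ 2 + (E1 * sin x1 - E2 * sin x2) ^+ 2 =
    (E1 - E2) ^+ 2 + E1 * E2 * (2 * (1 - cos (x1 - x2))).
  have := cos2Dsin2 x1; have := cos2Dsin2 x2; rewrite cosB => H1 H2.
  transitivity (E1 ^+ 2 * (cos x1 ^+ 2 + sin x1 ^+ 2) +
    E2 ^+ 2 * (cos x2 ^+ 2 + sin x2 ^+ 2) -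
    2 * E1 * E2 * (cos x1 * cos x2 + sin x1 * sin x2)); first by ring.
  by rewrite H1 H2; ring.
have E12 : 0 <= E1 * E2 <= 1.
  rewrite mulr_ge0 ?expR_ge0// -expRD expR_le1; lra.
have C0 : 0 <= 2 * (1 - cos (x1 - x2)) by rewrite mulr_ge0// subr_ge0 cos_le1.
have Cx : E1 * E2 * (2 * (1 - cos (x1 - x2))) <= (x1 - x2) ^+ 2.
  have [/eqP ->|xn] := boolP (x1 - x2 == 0); first by rewrite cos0 subrr !mulr0.
  have {}C := subr1_cos_lt xn; case/andP: E12 => *.
  by apply: le_trans (ltW C); rewrite ler_piMl.
(* Strictness comes from the moduli when they differ, and otherwise from the angles. *)
have [y12|y12] := eqVneq y1 y2; last first.
  by rewrite addrC ler_ltD// expR_sub2_lt.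
have xn : x1 - x2 != 0.
  by apply: contraNneq x12 => /eqP; rewrite subr_eq0 y12 => /eqP ->.
rewrite /E1 /E2 y12 !subrr expr0n/= add0r addr0 -/E2.
apply: le_lt_trans (subr1_cos_lt xn); rewrite ler_piMl//.
by case/andP: E12; rewrite /E1 y12.
Qed.
End contraction.

(** * The real-valued modulus on the complex numbers *)

Section complex_modulus.
Variable R : realType.
Local Notation C := R[i].

(* [Normc.normc] with its codomain displayed as the type [R] itself, which the
   canonical structures of [R] require. *)
Definition cabs (z : C) : R := Normc.normc z.

Lemma cabs0 : cabs 0 = 0. Proof. exact: Normc.normc0. Qed.

Lemma cabs1 : cabs 1 = 1. Proof. exact: Normc.normc1. Qed.

Lemma cabsM (z w : C) : cabs (z * w) = cabs z * cabs w.
Proof. exact: Normc.normcM. Qed.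

Lemma ReD (z w : C) : Re (z + w) = Re z + Re w.
Proof. by case: z; case: w. Qed.

Lemma ImD (z w : C) : Im (z + w) = Im z + Im w.
Proof. by case: z; case: w. Qed.

Lemma ReB (z w : C) : Re (z - w) = Re z - Re w.
Proof. by case: z; case: w. Qed.

Lemma ImB (z w : C) : Im (z - w) = Im z - Im w.
Proof. by case: z; case: w. Qed.

Lemma cabs_ge0 (z : C) : 0 <= cabs z.
Proof. by case: z => a b; exact: sqrtr_ge0. Qed.

Lemma cabsD (z w : C) : cabs (z + w) <= cabs z + cabs w.
Proof. exact: le_normcD. Qed.

Lemma cabs_opp (z : C) : cabs (- z) = cabs z.
Proof. exact: normcN. Qed.

Lemma cabsX (z : C) n : cabs (z ^+ n) = cabs z ^+ n.
Proof. by elim: n => [|n IH]; rewrite ?expr0 ?cabs1// !exprS cabsM IH. Qed.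

Lemma cabs_conj (z : C) : cabs (conjc z) = cabs z.
Proof. by case: z => a b /=; rewrite sqrrN. Qed.

Lemma cabs_real (x : R) : cabs x%:C = `|x|.
Proof. by rewrite /= expr0n addr0 sqrtr_sqr. Qed.

Lemma normr_Re_le (z : C) : `|Re z| <= cabs z.
Proof. by case: z => a b /=; rewrite -sqrtr_sqr ler_wsqrtr// lerDl sqr_ge0. Qed.

Lemma normr_Im_le (z : C) : `|Im z| <= cabs z.
Proof. by case: z => a b /=; rewrite -sqrtr_sqr ler_wsqrtr// lerDr sqr_ge0. Qed.

Lemma cabs_le_ReIm (z : C) : cabs z <= `|Re z| + `|Im z|.
Proof.
case: z => a b /=; rewrite -[leRHS]ger0_norm ?addr_ge0//.
rewrite -sqrtr_sqr ler_wsqrtr//.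
rewrite sqrrD !real_normK ?num_real// lerD2r lerDl.
by rewrite mulrn_wge0// mulr_ge0.
Qed.

Lemma cabs_sum (I : Type) (t : seq I) (P : pred I) (F : I -> C) :
  cabs (\sum_(i <- t | P i) F i) <= \sum_(i <- t | P i) cabs (F i).
Proof.
apply: (big_ind2 (fun z x => cabs z <= x)); rewrite ?cabs0//.
by move=> z x w y zx wy; apply: le_trans (cabsD _ _) (lerD zx wy).
Qed.

End complex_modulus.

(** * Polynomials in two real variables with a weighted l^1 bound on their coefficients *)

Section polynomial_majorant.
Variable R : realType.
Local Notation C := R[i].
Implicit Types (h l r M N : R) (s : seq (C * (nat * nat))) (f g : R -> R -> C).

(* A list of terms c h^i l^j, not necessarily in normal form: addition is
   concatenation, and the norm of a product of lists is the product of the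
   norms. *)
Definition monomials_eval s h l : C :=
  \sum_(t <- s) t.1 * (h%:C ^+ t.2.1 * l%:C ^+ t.2.2).

Definition monomials_norm r s : R :=
  \sum_(t <- s) cabs t.1 * (r ^+ t.2.1 * r ^+ t.2.2).

(** Stated for functions, so that a bound passes along any pointwise identity whatever list
    represents the polynomial. The bound is submultiplicative and dominates the modulus on the
    square of half-side [r]. *)
Definition poly_le r f M : Prop :=
  exists2 s, (forall h l, f h l = monomials_eval s h l) &
    monomials_norm r s <= M.

Lemma monomials_norm_ge0 r s : 0 <= r -> 0 <= monomials_norm r s.
Proof.
by move=> r0; apply: sumr_ge0 => t _; rewrite !mulr_ge0 ?cabs_ge0 ?exprn_ge0.
Qed.

Lemma poly_le_ge0 r f M : 0 <= r -> poly_le r f M -> 0 <= M.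
Proof. by move=> r0 [s _]; apply: le_trans; exact: monomials_norm_ge0. Qed.

Lemma poly_le_weaken r f M N : M <= N -> poly_le r f M -> poly_le r f N.
Proof. by move=> MN [s fs sM]; exists s => //; exact: le_trans MN. Qed.

Lemma eq_poly_le r f g M :
  (forall h l, f h l = g h l) -> poly_le r f M -> poly_le r g M.
Proof. by move=> fg [s fs sM]; exists s => // h l; rewrite -fg. Qed.

Lemma poly_le_cst r (c : C) : poly_le r (fun _ _ => c) (cabs c).
Proof.
exists [:: (c, (0, 0)%N)]; last by rewrite /monomials_norm big_seq1 !mulr1.
by move=> h l; rewrite /monomials_eval big_seq1 /= !expr0 !mulr1.
Qed.

Lemma poly_le0 r : poly_le r (fun _ _ => 0) 0.
Proof. by have := poly_le_cst r 0; rewrite cabs0. Qed.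

Lemma poly_le_fst r : poly_le r (fun h _ => h%:C) r.
Proof.
exists [:: (1, (1, 0)%N)]; last first.
  by rewrite /monomials_norm big_seq1 cabs1 /= mul1r mulr1.
by move=> h l; rewrite /monomials_eval big_seq1 /= expr0 mulr1 mul1r.
Qed.

Lemma poly_le_snd r : poly_le r (fun _ l => l%:C) r.
Proof.
exists [:: (1, (0, 1)%N)]; last first.
  by rewrite /monomials_norm big_seq1 cabs1 /= !mul1r.
by move=> h l; rewrite /monomials_eval big_seq1 /= expr0 !mul1r.
Qed.

Lemma poly_leD r f g M N : poly_le r f M -> poly_le r g N ->
  poly_le r (fun h l => f h l + g h l) (M + N).
Proof.
move=> [s fs sM] [u gu uN]; exists (s ++ u).
  by move=> h l; rewrite fs gu /monomials_eval big_cat.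
by rewrite /monomials_norm big_cat lerD.
Qed.

Lemma poly_leM r f g M N : 0 <= r -> poly_le r f M -> poly_le r g N ->
  poly_le r (fun h l => f h l * g h l) (M * N).
Proof.
move=> r0 [s fs sM] [u gu uN].
exists [seq (x.1 * y.1, (x.2.1 + y.2.1, x.2.2 + y.2.2)%N) | x <- s, y <- u].
  move=> h l; rewrite fs gu /monomials_eval big_allpairs_dep mulr_suml.
  apply: eq_bigr => x _; rewrite mulr_sumr; apply: eq_bigr => y _ /=.
  by rewrite !exprD; ring.
apply: (@le_trans _ _ (monomials_norm r s * monomials_norm r u)); last first.
  by rewrite ler_pM// monomials_norm_ge0.
rewrite le_eqVlt; apply/orP; left; apply/eqP.
rewrite /monomials_norm big_allpairs_dep mulr_suml.
apply: eq_bigr => x _; rewrite mulr_sumr; apply: eq_bigr => y _.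
by rewrite [in LHS]/fst [in LHS]/snd cabsM !exprD; ring.
Qed.

Lemma poly_leZ r (c : C) f M : 0 <= r -> poly_le r f M ->
  poly_le r (fun h l => c * f h l) (cabs c * M).
Proof. by move=> r0; apply: poly_leM => //; exact: poly_le_cst. Qed.

Lemma poly_leN r f M : 0 <= r -> poly_le r f M ->
  poly_le r (fun h l => - f h l) M.
Proof.
move=> r0 /(poly_leZ (-1) r0); rewrite cabs_opp cabs1 mul1r.
by apply: eq_poly_le => h l; rewrite mulN1r.
Qed.

Lemma poly_leX r f M n : 0 <= r -> poly_le r f M ->
  poly_le r (fun h l => f h l ^+ n) (M ^+ n).
Proof.
move=> r0 fM; elim: n => [|n IH].
  by have := poly_le_cst r 1; rewrite cabs1.
rewrite exprS; apply: eq_poly_le (poly_leM r0 fM IH) => h l.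
by rewrite exprS.
Qed.

Lemma poly_le_sum r n (F : nat -> R -> R -> C) (M : nat -> R) :
  (forall i, (i < n)%N -> poly_le r (F i) (M i)) ->
  poly_le r (fun h l => \sum_(i < n) F i h l) (\sum_(i < n) M i).
Proof.
elim: n => [|n IH] FM.
  rewrite big_ord0; apply: eq_poly_le (poly_le0 r) => h l.
  by rewrite big_ord0.
rewrite big_ord_recr /=.
apply: eq_poly_le (poly_leD (IH _) (FM n (ltnSn n))) => [h l|i ni].
  by rewrite big_ord_recr.
exact/FM/ltnW.
Qed.

(** The variables are real, so conjugation only affects the coefficients; this lets the
    antiholomorphic equation be treated by power series in [h] and [l]. *)
Lemma poly_le_conj r f M : poly_le r f M ->
  poly_le r (fun h l => conjc (f h l)) M.
Proof.
move=> [s fs sM]; exists [seq (conjc t.1, t.2) | t <- s].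
  move=> h l; rewrite fs /monomials_eval rmorph_sum big_map.
  apply: eq_bigr => t _; rewrite rmorphM; congr (_ * _).
  have -> : h%:C ^+ t.2.1 * l%:C ^+ t.2.2 = (h ^+ t.2.1 * l ^+ t.2.2)%:C.
    by rewrite rmorphM !rmorphXn.
  exact: conjc_real.
rewrite /monomials_norm big_map; under eq_bigr do rewrite cabs_conj.
exact: sM.
Qed.

Lemma poly_le_cabs r f M h l : poly_le r f M -> `|h| <= r -> `|l| <= r ->
  cabs (f h l) <= M.
Proof.
move=> [s fs sM] hr lr; rewrite fs; apply: le_trans sM.
apply: le_trans (cabs_sum _ _ _) _; apply: ler_sum => t _.
rewrite !cabsM !cabsX !cabs_real ler_wpM2l ?cabs_ge0//.
have r0 : 0 <= r := le_trans (normr_ge0 h) hr.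
by rewrite ler_pM ?exprn_ge0// lerXn2r.
Qed.

End polynomial_majorant.

(** * Real analyticity of a limit of polynomials with summable majorants *)

Section analytic_limit.
Variable R : realType.
Local Notation C := R[i].
Implicit Types (K r : R).

(** After exchanging the sums, each entry of [s] is counted once if its key lies in the square, and
    otherwise not at all. *)
Lemma sum_over_squares (T : Type) (s : seq T) (key : T -> nat * nat)
    (F : T -> R) N :
  \sum_(i < N) \sum_(j < N) \sum_(t <- s | key t == (i : nat, j : nat)) F t =
  \sum_(t <- s | ((key t).1 < N)%N && ((key t).2 < N)%N) F t.
Proof.
under eq_bigr => i _.
  under eq_bigr => j _ do rewrite big_mkcond.
  rewrite exchange_big.
  over.
rewrite exchange_big [RHS]big_mkcond; apply: eq_bigr => t _ /=.
case: (key t) => a b /=.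
have [aN|aN] /= := ltnP a N; last first.
  rewrite big1// => i _; rewrite big1// => j _; case: eqP => // -[ai _].
  by have := ltn_ord i; rewrite -ai ltnNge aN.
have [bN|bN] := ltnP b N; last first.
  rewrite big1// => i _; rewrite big1// => j _; case: eqP => // -[_ bj].
  by have := ltn_ord j; rewrite -bj ltnNge bN.
rewrite (bigD1 (Ordinal aN))//= (bigD1 (Ordinal bN))//= eqxx.
rewrite big1 => [|j jb]; last first.
  by case: eqP => // -[bj]; move: jb; rewrite -val_eqE /= bj eqxx.
rewrite big1 ?addr0// => i ia; rewrite big1// => j _.
by case: eqP => // -[ai _]; move: ia; rewrite -val_eqE /= ai eqxx.
Qed.

Lemma near_sum_over_squares (T : Type) (s : seq T) (key : T -> nat * nat)
    (F : T -> R) :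
  \forall N \near \oo,
  \sum_(i < N) \sum_(j < N) \sum_(t <- s | key t == (i : nat, j : nat)) F t =
  \sum_(t <- s) F t.
Proof.
have [N0 sN0] : exists N0, forall N, (N0 <= N)%N ->
    all (fun t => ((key t).1 < N)%N && ((key t).2 < N)%N) s.
  elim: s => [|t s [N0 IH]]; first by exists 0%N.
  exists (maxn N0 (maxn (key t).1 (key t).2).+1) => N.
  by rewrite geq_max => /andP[/IH sN tN] /=; rewrite sN andbT -gtn_max.
exists N0 => // N /= /sN0 sN; rewrite sum_over_squares.
elim: s sN {sN0} => [|t s IH] /=; first by rewrite !big_nil.
by move=> /andP[tN /IH sN]; rewrite !big_cons tN sN.
Qed.

(** Every finite set of indices lies in some square. *)
Lemma square_bounded_summable (a : nat -> nat -> R) K :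
  (forall N, \sum_(i < N) \sum_(j < N) `|a i j| <= K) ->
  summable [set: nat * nat] (fun n => (a n.1 n.2)%:E).
Proof.
move=> aK; apply: (@le_lt_trans _ _ K%:E); last exact: ltry.
apply: ge_ereal_sup => _ [A [finA _] <-].
rewrite fsbig_finite//= sumEFin lee_fin.
have := finmap.fset_uniq (fset_set A).
move: (finmap.enum_fset _) => s us.
have [N _ /(_ N (leqnn N))<-] :=
  near_sum_over_squares s id (fun t => `|a t.1 t.2|).
apply: le_trans (aK N); apply: ler_sum => i _; apply: ler_sum => j _.
have [ijs|ijs] := boolP ((i : nat, j : nat) \in s).
  rewrite -big_filter filter_pred1_uniq//.
  by rewrite big_seq1.
rewrite big_seq_cond big1// => t /andP[ts /eqP tij].
by move: ijs; rewrite -tij ts.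
Qed.

Lemma cvg_square_sum (b : nat -> nat -> nat -> R) (a : nat -> nat -> R) N :
  (forall i j, b n i j @[n --> \oo] --> a i j) ->
  \sum_(i < N) \sum_(j < N) b n i j @[n --> \oo] -->
  \sum_(i < N) \sum_(j < N) a i j.
Proof.
move=> ba; apply: cvg_big => [|i _]; first exact: add_continuous.
by apply: cvg_big => [|j _]; [exact: add_continuous|exact: ba].
Qed.

(** Normal form of the real part: terms with equal exponents are merged, and [Re] passes to the
    coefficients because the variables are real. *)
Definition monomials_coef (s : seq (C * (nat * nat))) i j : R :=
  \sum_(t <- s | t.2 == (i, j)) Re t.1.

Lemma monomials_coef_norm r s N : 0 <= r ->
  \sum_(i < N) \sum_(j < N) `|monomials_coef s i j| * (r ^+ i * r ^+ j) <=
  monomials_norm r s.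
Proof.
move=> r0; rewrite /monomials_norm.
set F := fun t : C * (nat * nat) => cabs t.1 * (r ^+ t.2.1 * r ^+ t.2.2).
have F0 t : 0 <= F t by rewrite !mulr_ge0 ?cabs_ge0 ?exprn_ge0.
apply: (@le_trans _ _
    (\sum_(i < N) \sum_(j < N) \sum_(t <- s | t.2 == (i : nat, j : nat)) F t)).
  apply: ler_sum => i _; apply: ler_sum => j _.
  apply: le_trans (ler_wpM2r _ (ler_norm_sum _ _ _)) _.
    by rewrite mulr_ge0 ?exprn_ge0.
  rewrite mulr_suml; apply: ler_sum => t /eqP tij.
  by rewrite /F tij ler_wpM2r ?normr_Re_le// mulr_ge0 ?exprn_ge0.
rewrite sum_over_squares big_mkcond; apply: ler_sum => t _.
by case: ifP => // _; exact: F0.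
Qed.

Lemma near_monomials_coef s (h l : R) : \forall N \near \oo,
  \sum_(i < N) \sum_(j < N) monomials_coef s i j * h ^+ i * l ^+ j =
  Re (monomials_eval s h l).
Proof.
set F := fun t : C * (nat * nat) => Re t.1 * h ^+ t.2.1 * l ^+ t.2.2.
have -> : Re (monomials_eval s h l) = \sum_(t <- s) F t.
  rewrite /monomials_eval; elim: s => [|t s IH]; first by rewrite !big_nil.
  rewrite !big_cons ReD IH; congr (_ + _); rewrite /F.
  case: t => -[u v] [i j] /=.
  by rewrite -!rmorphXn -rmorphM /= mulr0 subr0 mulrA.
have [N0 _ H] := near_sum_over_squares s snd F.
exists N0 => // N /= /H <-; apply: eq_bigr => i _; apply: eq_bigr => j _.
rewrite !mulr_suml; apply: eq_bigr => t /eqP tij.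
by rewrite /F tij.
Qed.

Lemma nonneg_bounded_series_cvg (u : nat -> R) K :
  (forall k, 0 <= u k) -> (forall n, \sum_(k < n) u k <= K) -> cvgn (series u).
Proof.
move=> u0 uK; apply: nondecreasing_is_cvgn.
  exact: (nondecreasing_series (fun n _ _ => u0 n)).
by exists K => _ [n _ <-]; rewrite /series /= big_mkord.
Qed.

(** Summable majorants make the coefficients of the partial sums converge, with tails bounded
    uniformly over all squares. The coefficientwise limit is therefore absolutely summable and has
    the pointwise limit as its sum. *)
Lemma series_real_analytic r (D : nat -> R -> R -> C) (M : nat -> R) K
    (g : R * R -> R) p :
  0 < r -> (forall k, poly_le r (D k) (M k)) ->
  (forall n, \sum_(k < n) M k <= K) ->
  (forall h l, `|h| < r -> `|l| < r ->
    Re (\sum_(k < n) D k h l) @[n --> \oo] --> g (p.1 + h, p.2 + l)) ->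
  real_analytic_at g p.
Proof.
move=> r0 DM MK Dg.
have r_ge0 := ltW r0.
have M0 k : 0 <= M k := poly_le_ge0 r_ge0 (DM k).
have /choice[s sP] k : exists s,
    (forall h l, D k h l = monomials_eval s h l) /\ monomials_norm r s <= M k.
  by have [s] := DM k; exists s.
pose A k i j := monomials_coef (s k) i j.
pose b n i j := \sum_(k < n) A k i j.
have AM k N : \sum_(i < N) \sum_(j < N) `|A k i j| * (r ^+ i * r ^+ j) <= M k.
  exact: le_trans (monomials_coef_norm _ _ r_ge0) (sP k).2.
have rr_gt0 i j : 0 < r ^+ i * r ^+ j by rewrite mulr_gt0 ?exprn_gt0.
(* A Cauchy estimate: one coefficient is a single term of the weighted norm. *)
have AM1 k i j : `|A k i j| <= M k / (r ^+ i * r ^+ j).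
  rewrite ler_pdivlMr//; pose N := (maxn i j).+1.
  have iN : (i < N)%N by rewrite ltnS leq_maxl.
  have jN : (j < N)%N by rewrite ltnS leq_maxr.
  apply: le_trans (AM k N).
  rewrite (bigD1 (Ordinal iN))//= (bigD1 (Ordinal jN))//=.
  rewrite -addrA lerDl addr_ge0// !sumr_ge0// => [j' _|i' _].
    by rewrite mulr_ge0// ltW.
  by apply: sumr_ge0 => j' _; rewrite mulr_ge0// ltW.
have bcvg i j : cvgn (fun n => b n i j).
  have -> : (fun n => b n i j) = series (fun k => A k i j).
    by apply/funext => n; rewrite /series /= big_mkord.
  apply: normed_cvg.
  apply: (@nonneg_bounded_series_cvg _ (K / (r ^+ i * r ^+ j))) => [k|n].
    exact: normr_ge0.
  apply: (@le_trans _ _ (\sum_(k < n) M k / (r ^+ i * r ^+ j))).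
    by apply: ler_sum => k _; exact: AM1.
  by rewrite -mulr_suml ler_wpM2r// invr_ge0 ltW.
pose a i j := limn (fun n => b n i j).
have ba i j : b n i j @[n --> \oo] --> a i j := bcvg i j.
have Mcvg : cvgn (series M) by exact: nonneg_bounded_series_cvg MK.
pose L := limn (series M).
have ML n : \sum_(k < n) M k <= L.
  rewrite -(big_mkord xpredT M); apply: nondecreasing_cvgn_le Mcvg n.
  exact: (nondecreasing_series (fun n _ _ => M0 n)).
have bM n d N : \sum_(i < N) \sum_(j < N) `|b (d + n)%N i j - b n i j| *
    (r ^+ i * r ^+ j) <= \sum_(k < d + n) M k - \sum_(k < n) M k.
  elim: d => [|d IH].
    rewrite add0n subrr big1// => i _; rewrite big1// => j _.
    by rewrite subrr normr0 mul0r.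
  rewrite addSn big_ord_recr /= addrAC.
  apply: le_trans (lerD IH (AM (d + n)%N N)).
  rewrite -big_split; apply: ler_sum => i _; rewrite -big_split.
  apply: ler_sum => j _ /=; rewrite -mulrDl ler_wpM2r//; first exact: ltW.
  by rewrite /b big_ord_recr /= addrAC ler_normD.
(* Let the upper index in [bM] tend to infinity with the square fixed; the bound does not depend on
   [N]. *)
have tail n N : \sum_(i < N) \sum_(j < N) `|a i j - b n i j| *
    (r ^+ i * r ^+ j) <= L - \sum_(k < n) M k.
  have c : \sum_(i < N) \sum_(j < N) `|b m i j - b n i j| *
      (r ^+ i * r ^+ j) @[m --> \oo] -->
      \sum_(i < N) \sum_(j < N) `|a i j - b n i j| * (r ^+ i * r ^+ j).
    apply: (@cvg_square_sum
        (fun m i j => `|b m i j - b n i j| * (r ^+ i * r ^+ j))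
        (fun i j => `|a i j - b n i j| * (r ^+ i * r ^+ j))) => i j.
    apply: cvgM; last exact: cvg_cst.
    by apply: cvg_norm; apply: cvgB => //; exact: cvg_cst.
  apply: (cvgr_to_le c); exists n => // m /= nm.
  by rewrite -(subnK nm); apply: le_trans (bM _ _ _) _; rewrite lerD2r.
exists a, r => // h l hr lr.
have hl i j : `|h ^+ i * l ^+ j| <= r ^+ i * r ^+ j.
  by rewrite normrM !normrX ler_pM ?exprn_ge0// lerXn2r ?nnegrE// ltW.
split.
  apply: (@square_bounded_summable (fun i j => a i j * h ^+ i * l ^+ j) L) => N.
  have := tail 0%N N; rewrite big_ord0 subr0; apply: le_trans.
  apply: ler_sum => i _; apply: ler_sum => j _; rewrite /b big_ord0 subr0.
  by rewrite -mulrA normrM ler_wpM2l.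
have bS n : \forall N \near \oo,
    \sum_(i < N) \sum_(j < N) b n i j * h ^+ i * l ^+ j =
    Re (\sum_(k < n) D k h l).
  elim: n => [|n IH].
    near=> N; rewrite big_ord0 big1// => i _; rewrite big1// => j _.
    by rewrite /b big_ord0 !mul0r.
  near=> N; rewrite big_ord_recr ReD.
  rewrite -(near IH N)// (sP n).1 -(near (near_monomials_coef (s n) h l) N)//.
  rewrite -big_split; apply: eq_bigr => i _; rewrite -big_split.
  by apply: eq_bigr => j _; rewrite /b big_ord_recr /= -/(A n i j) !mulrDl.
(* Choose [n] so that both the value and the majorant sum are within [e / 2] of their limits. For
   large [N] the square sum of the [n]-th polynomial is exactly its value. *)
apply/cvgrPdist_le => e e0.
have e2 : 0 < e / 2 by rewrite divr_gt0.
have [n [gn Mn]] : exists n,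
    `|g (p.1 + h, p.2 + l) - Re (\sum_(k < n) D k h l)| <= e / 2 /\
    `|L - \sum_(k < n) M k| <= e / 2.
  apply: (@filter_ex _ \oo).
  near=> n; split; near: n; first by move/cvgrPdist_le : (Dg h l hr lr); exact.
  move/cvgrPdist_le : Mcvg => /(_ _ e2); apply: filterS => n.
  by rewrite /series /= big_mkord.
near=> N.
rewrite -(subrKA (Re (\sum_(k < n) D k h l))) (splitr e).
apply: le_trans (ler_normD _ _) _; apply: lerD => //.
rewrite -(near (bS n) N)//; apply: le_trans Mn; apply: le_trans (ler_norm _).
rewrite -sumrB; apply: le_trans (tail n N).
apply: le_trans (ler_norm_sum _ _ _) _; apply: ler_sum => i _.
rewrite -sumrB; apply: le_trans (ler_norm_sum _ _ _) _; apply: ler_sum => j _.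
by rewrite -!mulrA -mulrBl normrM distrC ler_wpM2l.
Unshelve. all: by end_near. Qed.

End analytic_limit.

(** * Partial sums of the exponential series, real and complex *)

Section exponential_sums.

(** Generic in the field: complex sums are compared with real ones at the moduli. *)
Definition exp_sum (K : fieldType) n (z : K) : K :=
  \sum_(i < n) z ^+ i / i`!%:R.

(** The binomial theorem, regrouped over the triangle [i + j < n]. *)
Lemma exp_sumD (K : numFieldType) n (x y : K) :
  exp_sum n (x + y) =
  \sum_(i < n) \sum_(j < n | (j < n - i)%N) x ^+ i / i`!%:R * (y ^+ j / j`!%:R).
Proof.
pose G i j := x ^+ i / i`!%:R * (y ^+ j / j`!%:R).
have factN0 m : m`!%:R != 0 :> K by rewrite pnatr_eq0 -lt0n fact_gt0.
have termE m : (x + y) ^+ m / m`!%:R = \sum_(i < m.+1) G i (m - i)%N.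
  rewrite addrC exprDn mulr_suml; apply: eq_bigr => i _; rewrite /G.
  have im : (i <= m)%N by rewrite -ltnS.
  rewrite -(bin_fact im) -mulr_natr !natrM.
  have Cn0 : 'C(m, i)%:R != 0 :> K by rewrite pnatr_eq0 -lt0n bin_gt0.
  by field; rewrite Cn0 !factN0.
transitivity (\sum_(i < n) \sum_(j < n - i) G i j).
  rewrite /exp_sum; elim: n => [|n IH]; first by rewrite !big_ord0.
  rewrite !big_ord_recr /= IH termE big_ord_recr /= subSnn subnn big_ord1 addrA.
  congr (_ + _); rewrite -big_split; apply: eq_bigr => i _ /=.
  by rewrite subSn ?big_ord_recr// ltnW.
by apply: eq_bigr => i _; rewrite (big_ord_widen n (G i)) ?leq_subr.
Qed.

Lemma exp_sumM_sub (K : numFieldType) n (x y : K) :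
  exp_sum n x * exp_sum n y - exp_sum n (x + y) =
  \sum_(i < n) \sum_(j < n | ~~ (j < n - i)%N)
    x ^+ i / i`!%:R * (y ^+ j / j`!%:R).
Proof.
rewrite exp_sumD /exp_sum mulr_suml -sumrB; apply: eq_bigr => i _.
rewrite mulr_sumr [X in X - _](bigID (fun j : 'I_n => (j < n - i)%N)) /=.
by rewrite addrAC subrr add0r.
Qed.

Variable R : realType.
Local Notation C := R[i].
Implicit Types x y : R.

Lemma cvg_exp_sum x : exp_sum n x @[n --> \oo] --> expR x.
Proof.
have -> : (fun n => exp_sum n x) = series (exp_coeff x).
  by apply/funext => n; rewrite /series /= big_mkord.
exact: is_cvg_series_exp_coeff.
Qed.

Lemma exp_sum_le n x : 0 <= x -> exp_sum n x <= expR x.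
Proof.
move=> x0.
apply: (@cvgr_to_ge _ _ _ R (fun m => exp_sum m x) _ _ (@cvg_exp_sum x)).
exists n => // m /= nm.
rewrite /exp_sum (big_ord_widen m (fun i => x ^+ i / i`!%:R))//.
rewrite [leRHS](bigID (fun i : 'I_m => (i < n)%N)) /= lerDl.
by apply: sumr_ge0 => i _; rewrite divr_ge0// exprn_ge0.
Qed.

Lemma cabs_term (z : C) i : cabs (z ^+ i / i`!%:R) = cabs z ^+ i / i`!%:R.
Proof.
rewrite cabsM cabsX; congr (_ * _).
have -> : (i`!%:R^-1 : C) = (i`!%:R^-1)%:C by rewrite fmorphV rmorph_nat.
by rewrite cabs_real ger0_norm// invr_ge0.
Qed.

(** The defect is a sum, outside the triangle, of monomials with positive coefficients. It is thus
    dominated by the same defect at the moduli, which tends to 0 by the addition formula for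
    [expR]. *)
Lemma cvg_exp_sumM_sub (z w : C) :
  cabs (exp_sum n z * exp_sum n w - exp_sum n (z + w)) @[n --> \oo] --> 0.
Proof.
have c : exp_sum n (cabs z) * exp_sum n (cabs w) - exp_sum n (cabs z + cabs w)
    @[n --> \oo] --> 0.
  rewrite -(subrr (expR (cabs z + cabs w))) {1}expRD.
  by apply: cvgB; [apply: cvgM|]; exact: cvg_exp_sum.
apply: squeeze_cvgr (cvg_cst 0) c; near=> n; rewrite cabs_ge0 !exp_sumM_sub/=.
apply: le_trans (cabs_sum _ _ _) _; apply: ler_sum => i _.
apply: le_trans (cabs_sum _ _ _) _; apply: ler_sum => j _.
by rewrite cabsM !cabs_term.
Unshelve. all: by end_near. Qed.

Lemma exp_sum_real n x : exp_sum n x%:C = (exp_sum n x)%:C.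
Proof.
rewrite /exp_sum rmorph_sum; apply: eq_bigr => i _.
by rewrite rmorphM rmorphXn fmorphV rmorph_nat.
Qed.

Lemma exp_sum_imag n x :
  exp_sum n (0 +i* x) = series (cos_coeff x) n +i* series (sin_coeff x) n.
Proof.
rewrite /exp_sum /series /= !big_mkord.
elim: n => [|n IH]; first by rewrite !big_ord0.
rewrite !big_ord_recr /= IH.
suff -> : (0 +i* x) ^+ n / n`!%:R = cos_coeff x n +i* sin_coeff x n :> C by [].
have -> : (n`!%:R^-1 : C) = (n`!%:R^-1)%:C by rewrite fmorphV rmorph_nat.
rewrite /cos_coeff /sin_coeff /= -exprnP.
have sqr m : (0 +i* x) ^+ m.*2 = ((-1) ^+ m * x ^+ m.*2)%:C :> C.
  elim: m => [|m IHm]; first by rewrite !expr0 mul1r.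
  rewrite doubleS !exprS IHm; apply/eqP; rewrite eq_complex /=.
  by apply/andP; split; apply/eqP; ring.
(* The parity selectors have the shape of [cos_coeff] and [sin_coeff]. *)
have -> : (0 +i* x) ^+ n = ((~~ odd n)%:R * (-1) ^+ n./2 * x ^+ n) +i*
    ((odd n)%:R * (-1) ^+ n.-1./2 * x ^+ n) :> C.
  have [m [->|->]] : exists m, n = m.*2 \/ n = m.*2.+1.
    exists n./2; rewrite -{1 3}(odd_double_half n).
    by case: (odd n); [right|left].
  - rewrite sqr odd_double doubleK; apply/eqP; rewrite eq_complex /=.
    by apply/andP; split; apply/eqP; ring.
  - rewrite exprS sqr /= odd_double doubleK exprS; apply/eqP.
    by rewrite eq_complex /=; apply/andP; split; apply/eqP; ring.
by apply/eqP; rewrite eq_complex /=; apply/andP; split; apply/eqP; ring.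
Qed.

(** The polar form gives the modulus and the link with [wave] directly; agreement with the power
    series is [cvg_exp_sum_complex]. *)
Definition cexp (z : C) : C :=
  (expR (Re z) * cos (Im z)) +i* (expR (Re z) * sin (Im z)).

(** The product of the partial sums at the real and imaginary parts of [z] converges to the polar
    form, and differs from [exp_sum n z] by a null sequence. *)
Lemma cvg_exp_sum_complex (z : C) :
  Re (exp_sum n z) @[n --> \oo] --> Re (cexp z) /\
  Im (exp_sum n z) @[n --> \oo] --> Im (cexp z).
Proof.
pose P n := (exp_sum n (Re z))%:C *
  (series (cos_coeff (Im z)) n +i* series (sin_coeff (Im z)) n).
have PE n : P n = exp_sum n (Re z)%:C * exp_sum n (0 +i* Im z).
  by rewrite exp_sum_real exp_sum_imag.
have zE : z = (Re z)%:C + (0 +i* Im z).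
  by case: z {P PE} => a b; apply/eqP; rewrite eq_complex /= addr0 add0r !eqxx.
have Pz : cabs (P n - exp_sum n z) @[n --> \oo] --> 0.
  rewrite [in X in X @ _](_ : (fun n => _) = (fun n => cabs
    (exp_sum n (Re z)%:C * exp_sum n (0 +i* Im z) -
     exp_sum n ((Re z)%:C + (0 +i* Im z))))); first exact: cvg_exp_sumM_sub.
  by apply/funext => n; rewrite PE -zE.
have small (f : C -> R) (u : nat -> R) : (forall w, `|f w| <= cabs w) ->
    (forall n, f (P n - exp_sum n z) = u n) -> u n @[n --> \oo] --> 0.
  move=> fc fu; apply/norm_cvg0P; apply: squeeze_cvgr (cvg_cst 0) Pz.
  by near=> n; rewrite normr_ge0 -fu fc.
have ReP : Re (P n) @[n --> \oo] --> Re (cexp z).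
  rewrite /P /=; under eq_fun do rewrite mul0r subr0.
  apply: cvgM; first exact: cvg_exp_sum.
  rewrite cos.unlock; exact: is_cvg_series_cos_coeff.
have ImP : Im (P n) @[n --> \oo] --> Im (cexp z).
  rewrite /P /=; under eq_fun do rewrite mul0r addr0.
  apply: cvgM; first exact: cvg_exp_sum.
  rewrite sin.unlock; exact: is_cvg_series_sin_coeff.
split.
- have -> : (fun n => Re (exp_sum n z)) =
      (fun n => Re (P n) - Re (P n - exp_sum n z)).
    by apply/funext => n; rewrite -ReB subKr.
  rewrite -[X in _ --> X]subr0; apply: cvgB => //.
  exact: small (@normr_Re_le R) _.
- have -> : (fun n => Im (exp_sum n z)) =
      (fun n => Im (P n) - Im (P n - exp_sum n z)).
    by apply/funext => n; rewrite -ImB subKr.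
  rewrite -[X in _ --> X]subr0; apply: cvgB => //.
  exact: small (@normr_Im_le R) _.
Unshelve. all: by end_near. Qed.

End exponential_sums.

Arguments cexp : simpl never.

(** * Limits of complex sequences through their real and imaginary parts *)

Section componentwise_convergence.
Variable R : realType.
Local Notation C := R[i].
Implicit Types (u v : nat -> C) (z w : C).

Definition ccvg u z : Prop :=
  Re (u n) @[n --> \oo] --> Re z /\ Im (u n) @[n --> \oo] --> Im z.

Lemma eq_complexP z w : Re z = Re w -> Im z = Im w -> z = w.
Proof. by case: z w => [a b] [a' b'] /= -> ->. Qed.

Lemma ccvg_unique u z w : ccvg u z -> ccvg u w -> z = w.
Proof.
move=> [uz uz'] [uw uw']; apply: eq_complexP.
- by rewrite -(cvg_lim _ uz)// -(cvg_lim _ uw).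
- by rewrite -(cvg_lim _ uz')// -(cvg_lim _ uw').
Qed.

Lemma eq_ccvg u v z : (forall n, u n = v n) -> ccvg u z -> ccvg v z.
Proof. by move=> /funext ->. Qed.

Lemma ccvg_cst z : ccvg (fun=> z) z.
Proof. by split; exact: cvg_cst. Qed.

Lemma ccvgS u z : ccvg u z -> ccvg (fun n => u n.+1) z.
Proof.
move=> [uz uz']; split.
- by rewrite (cvg_shiftS (fun n => Re (u n))).
- by rewrite (cvg_shiftS (fun n => Im (u n))).
Qed.

Lemma ccvgD u v z w : ccvg u z -> ccvg v w -> ccvg (fun n => u n + v n) (z + w).
Proof.
move=> [uz uz'] [vw vw']; split; rewrite ?ReD ?ImD.
- by under eq_fun do rewrite ReD; exact: cvgD.
- by under eq_fun do rewrite ImD; exact: cvgD.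
Qed.

Lemma ccvgM u v z w : ccvg u z -> ccvg v w -> ccvg (fun n => u n * v n) (z * w).
Proof.
have ReM (x y : C) : Re (x * y) = Re x * Re y - Im x * Im y by case: x; case: y.
have ImM (x y : C) : Im (x * y) = Re x * Im y + Im x * Re y by case: x; case: y.
move=> [uz uz'] [vw vw']; split; rewrite ?ReM ?ImM.
- by under eq_fun do rewrite ReM; apply: cvgB; apply: cvgM.
- by under eq_fun do rewrite ImM; apply: cvgD; apply: cvgM.
Qed.

Lemma ccvg_conj u z : ccvg u z -> ccvg (fun n => conjc (u n)) (conjc z).
Proof.
have Rec (x : C) : Re (conjc x) = Re x by case: x.
have Imc (x : C) : Im (conjc x) = - Im x by case: x.
move=> [uz uz']; split; rewrite ?Rec ?Imc.
- by under eq_fun do rewrite Rec.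
- by under eq_fun do rewrite Imc; exact: cvgN.
Qed.

Lemma ccvgN u z : ccvg u z -> ccvg (fun n => - u n) (- z).
Proof.
move=> uz; rewrite -mulN1r; apply: eq_ccvg (ccvgM (ccvg_cst (-1)) uz) => n.
by rewrite mulN1r.
Qed.

Lemma ccvg0P u : cabs (u n) @[n --> \oo] --> 0 <-> ccvg u 0.
Proof.
split=> [u0|[u0 u0']].
  by split; apply/norm_cvg0P; apply: squeeze_cvgr (cvg_cst 0) u0; near=> n;
    rewrite normr_ge0 ?normr_Re_le ?normr_Im_le.
have c : `|Re (u n)| + `|Im (u n)| @[n --> \oo] --> 0.
  by rewrite -[X in _ --> X]addr0; apply: cvgD; apply/norm_cvg0P.
apply: squeeze_cvgr (cvg_cst 0) c; near=> n.
by rewrite cabs_ge0 cabs_le_ReIm.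
Unshelve. all: by end_near. Qed.

Lemma ccvg_sub u v z :
  cabs (v n - u n) @[n --> \oo] --> 0 -> ccvg u z -> ccvg v z.
Proof.
move=> /ccvg0P vu uz; rewrite -[z]addr0; apply: eq_ccvg (ccvgD uz vu) => n.
by rewrite addrC subrK.
Qed.

Lemma ccvg_dist u z : ccvg u z -> cabs (u n - z) @[n --> \oo] --> 0.
Proof.
move=> uz; apply/ccvg0P; rewrite -(subrr z).
exact: ccvgD uz (ccvgN (ccvg_cst z)).
Qed.

Lemma ccvg_exp_sum z : ccvg (fun n => exp_sum n z) (cexp z).
Proof. exact: cvg_exp_sum_complex. Qed.

End componentwise_convergence.

(** * Majorants for compositions with the exponential *)

Section composition_majorants.
Variable R : realType.
Local Notation C := R[i].
Implicit Types (r rho M : R) (f g U : R -> R -> C).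

(** The common form of all coordinates to be treated: [S] is an exponential for the map and a Picard
    limit for its inverse. The polynomial [U] is put in front of the series as an extra term. *)
Lemma affine_series_real_analytic r (D : nat -> R -> R -> C) (M : nat -> R) K
    U MU (w : C) (S : R -> R -> C) (g : R * R -> R) p :
  0 < r -> poly_le r U MU -> (forall k, poly_le r (D k) (M k)) ->
  (forall n, \sum_(k < n) M k <= K) ->
  (forall h l, `|h| < r -> `|l| < r ->
    ccvg (fun n => \sum_(k < n) D k h l) (S h l)) ->
  (forall h l, `|h| < r -> `|l| < r ->
    g (p.1 + h, p.2 + l) = Re (U h l + w * S h l)) ->
  real_analytic_at g p.
Proof.
move=> r0 UM DM MK DS gE; have r_ge0 := ltW r0.
pose D' k h l := if k is k'.+1 then w * D k' h l else U h l.
pose M' k := if k is k'.+1 then cabs w * M k' else MU.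
apply: (@series_real_analytic _ r D' M' (MU + cabs w * K)) => //.
- by case=> [|k] //=; exact: poly_leZ.
- case=> [|n].
    rewrite big_ord0 addr_ge0 ?(poly_le_ge0 _ UM)// mulr_ge0 ?cabs_ge0//.
    by have := MK 0%N; rewrite big_ord0.
  rewrite big_ord_recl /= lerD2l.
  by apply: le_trans (ler_wpM2l (cabs_ge0 w) (MK n)); rewrite mulr_sumr.
- move=> h l hr lr; rewrite gE// -cvg_shiftS.
  have [c _] := ccvgD (ccvg_cst (U h l)) (ccvgM (ccvg_cst w) (DS h l hr lr)).
  apply: cvg_trans c; apply: near_eq_cvg; near=> n.
  by rewrite /= big_ord_recl /= mulr_sumr.
Unshelve. all: by end_near. Qed.

Lemma poly_le_exp_term r f rho i : 0 <= r -> poly_le r f rho ->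
  poly_le r (fun h l => f h l ^+ i / i`!%:R) (rho ^+ i / i`!%:R).
Proof.
move=> r0 fr; have := poly_leZ (i`!%:R^-1) r0 (poly_leX i r0 fr).
have := @cabs_term R 1 i; rewrite expr1n cabs1 expr1n !mul1r => ->.
by rewrite mulrC; apply: eq_poly_le => h l; rewrite mulrC.
Qed.

Lemma poly_le_exp_sumB r f g rho M n : 0 <= r -> 0 <= rho -> 0 <= M ->
  poly_le r f rho -> poly_le r g rho ->
  poly_le r (fun h l => f h l - g h l) M ->
  poly_le r (fun h l => exp_sum n (f h l) - exp_sum n (g h l)) (M * expR rho).
Proof.
move=> r0 rho0 M0 fr gr fgM.
pose F i h l : C := (f h l ^+ i - g h l ^+ i) / i`!%:R.
(* The constant terms cancel, hence the shift of the index. *)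
pose c i := if i is j.+1 then rho ^+ j / j`!%:R else 0.
have FE h l : exp_sum n (f h l) - exp_sum n (g h l) = \sum_(i < n) F i h l.
  by rewrite /exp_sum -sumrB; apply: eq_bigr => i _; rewrite /F mulrBl.
have Fc i : (i < n)%N -> poly_le r (F i) (M * c i).
  case: i => [|i] _.
    rewrite mulr0; apply: eq_poly_le (poly_le0 r) => h l.
    by rewrite /F !expr0 subrr mul0r.
  have Hi : poly_le r
      (fun h l => \sum_(j < i.+1) f h l ^+ (i - j) * g h l ^+ j)
      (rho ^+ i *+ i.+1).
    have := @poly_le_sum _ r i.+1 (fun j h l => f h l ^+ (i - j) * g h l ^+ j)
      (fun j => rho ^+ (i - j) * rho ^+ j).
    rewrite [X in poly_le _ _ X](_ : _ = rho ^+ i *+ i.+1); last first.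
      rewrite (eq_bigr (fun=> rho ^+ i)) ?sumr_const ?card_ord// => j _.
      by rewrite -exprD subnK// -ltnS.
    by apply=> j _; apply: poly_leM => //; exact: poly_leX.
  have := poly_leZ (i.+1`!%:R^-1) r0 (poly_leM r0 fgM Hi).
  have := @cabs_term R 1 i.+1; rewrite expr1n cabs1 expr1n !mul1r => ->.
  rewrite [X in poly_le _ _ X -> _](_ : _ = M * c i.+1).
    by apply: eq_poly_le => h l; rewrite /F subrXX mulrC.
  rewrite /c factS natrM -mulr_natr; field.
  by rewrite nat1r !pnatr_eq0 -lt0n fact_gt0.
suff H : poly_le r (fun h l => \sum_(i < n) F i h l) (M * expR rho).
  by apply: eq_poly_le H => h l; rewrite FE.
apply: poly_le_weaken (poly_le_sum Fc); rewrite -mulr_sumr ler_wpM2l//.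
case: n {Fc FE} => [|n]; first by rewrite big_ord0 expR_ge0.
by rewrite big_ord_recl /= add0r; exact: exp_sum_le.
Qed.

Lemma exp_sum0 (K : fieldType) n : exp_sum n.+1 (0 : K) = 1.
Proof.
rewrite /exp_sum big_ord_recl big1 => [|i _]; last by rewrite expr0n /= mul0r.
by rewrite expr0 divr1 addr0.
Qed.

Lemma poly_le_exp_sum r f rho n : 0 <= r -> 0 <= rho -> poly_le r f rho ->
  poly_le r (fun h l => exp_sum n.+1 (f h l) - 1) (rho * expR rho).
Proof.
move=> r0 rho0 fr.
have z : poly_le r (fun _ _ => 0 : C) rho by apply: poly_le_weaken (poly_le0 r).
apply: eq_poly_le (poly_le_exp_sumB n.+1 r0 rho0 rho0 fr z _) => [h l|].
  by rewrite exp_sum0.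
by apply: eq_poly_le fr => h l; rewrite subr0.
Qed.

(** The preceding majorant for constant polynomials, taken with radius 0. *)
Lemma cabs_exp_sumB (z w : C) rho n :
  0 <= rho -> cabs z <= rho -> cabs w <= rho ->
  cabs (exp_sum n z - exp_sum n w) <= cabs (z - w) * expR rho.
Proof.
move=> rho0 zr wr.
have z' : poly_le 0 (fun _ _ => z) rho := poly_le_weaken zr (poly_le_cst 0 z).
have w' : poly_le 0 (fun _ _ => w) rho := poly_le_weaken wr (poly_le_cst 0 w).
have := poly_le_exp_sumB n (lexx 0) rho0 (cabs_ge0 _) z' w'
  (poly_le_cst 0 (z - w)).
by move=> /(@poly_le_cabs _ _ _ _ 0 0); rewrite normr0; exact.
Qed.

End composition_majorants.

(** * Picard iteration for the fixed-point equation with conjugation *)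

Section analytic_fixed_point.
Variable R : realType.
Local Notation C := R[i].
Variables (E0 : C) (rho r : R) (tau : R -> R -> C).
Let q : R := cabs E0 * expR rho.
Hypotheses (rho_gt0 : 0 < rho) (r_gt0 : 0 < r) (q_lt1 : q < 1)
  (tau_le : poly_le r tau ((1 - q) * rho)).

(** The truncation order grows with the iteration, so the limit satisfies the equation with the full
    exponential. It starts at 1, where [exp_sum] already contains the constant term 1. *)
Fixpoint picard n (h l : R) : C :=
  if n is m.+1 then tau h l - conjc (E0 * (exp_sum m.+1 (picard m h l) - 1))
  else 0.

(** A step has two sources: the previous step contracted by [q], and the term by which the
    truncation is extended. *)
Let majorant := fix majorant n : R :=
  if n is m.+1 then q * majorant m + cabs E0 * (rho ^+ m.+1 / m.+1`!%:R)
  else rho.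

Let r_ge0 : 0 <= r := ltW r_gt0.
Let rho_ge0 : 0 <= rho := ltW rho_gt0.
Let q_ge0 : 0 <= q. Proof. by rewrite mulr_ge0 ?cabs_ge0 ?expR_ge0. Qed.

(** The ball of radius [rho] is invariant: the bound on [tau] leaves room [q * rho] for the
    exponential term. *)
Lemma picard_le n : poly_le r (picard n) rho.
Proof.
elim: n => [|n IH]; first exact: poly_le_weaken (poly_le0 r).
have -> : rho = (1 - q) * rho + cabs E0 * (rho * expR rho) by rewrite /q; ring.
apply: poly_leD tau_le _; apply/poly_leN/poly_le_conj/poly_leZ => //.
exact: poly_le_exp_sum.
Qed.

Lemma majorant_ge0 n : 0 <= majorant n.
Proof.
elim: n => //= n IH; rewrite addr_ge0 ?mulr_ge0 ?cabs_ge0 ?invr_ge0//.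
exact: exprn_ge0.
Qed.

Lemma picard_step_le n :
  poly_le r (fun h l => picard n.+1 h l - picard n h l) (majorant n).
Proof.
elim: n => [|n IH].
  by apply: eq_poly_le (picard_le 1) => h l; rewrite [picard 0 _ _]/= subr0.
have H1 := poly_le_exp_sumB n.+1 r_ge0 rho_ge0 (majorant_ge0 n)
  (picard_le n.+1) (picard_le n) IH.
have H2 := poly_le_exp_term n.+1 r_ge0 (picard_le n.+1).
have := poly_leN r_ge0 (poly_le_conj (poly_leZ E0 r_ge0 (poly_leD H1 H2))).
rewrite [X in poly_le _ _ X -> _](_ : _ = majorant n.+1); last first.
  by rewrite /= /q; ring.
apply: eq_poly_le => h l.
rewrite [picard n.+2 h l]/= [in X in _ = _ - X]/=.
set P := picard n h l; set P' := tau h l - conjc (E0 * (exp_sum n.+1 P - 1)).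
rewrite [exp_sum n.+2 P'](_ : _ = exp_sum n.+1 P' + P' ^+ n.+1 / n.+1`!%:R).
  have convE (t a b : C) : - conjc (a - b) = (t - conjc a) - (t - conjc b).
    by rewrite rmorphB; ring.
  rewrite -[picard n.+1 h l]/P' [in X in _ = _ - X]/P' -convE.
  by congr (- conjc _); ring.
by rewrite [LHS]big_ord_recr.
Qed.

(** The bound is the fixed point of [s |-> rho + q * s + q]; the last [q] dominates the sum of all
    truncation terms. *)
Lemma majorant_sum n : \sum_(k < n) majorant k <= (rho + q) / (1 - q).
Proof.
have q1 : 0 < 1 - q by rewrite subr_gt0.
elim: n => [|n IH].
  by rewrite big_ord0; apply: divr_ge0 (ltW q1); exact: addr_ge0.
rewrite big_ord_recl /= big_split /= -!mulr_sumr.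
have -> : (rho + q) / (1 - q) = rho + (q * ((rho + q) / (1 - q)) + q).
  by field; rewrite gt_eqF.
rewrite lerD2l; apply: lerD; first by rewrite ler_wpM2l.
rewrite /q ler_wpM2l ?cabs_ge0//.
apply: le_trans (exp_sum_le n.+1 rho_ge0).
by rewrite /exp_sum big_ord_recl lerDr divr_ge0 ?exprn_ge0.
Qed.

Lemma picard_telescope n h l :
  \sum_(k < n) (picard k.+1 h l - picard k h l) = picard n h l.
Proof.
elim: n => [|n IH]; first by rewrite big_ord0.
by rewrite [LHS]big_ord_recr IH; exact: subrKC.
Qed.

Definition picard_lim h l : C :=
  limn (fun n => Re (picard n h l)) +i* limn (fun n => Im (picard n h l)).

Lemma picard_cvg h l : `|h| < r -> `|l| < r ->
  ccvg (fun n => picard n h l) (picard_lim h l).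
Proof.
move=> hr lr.
have step k : cabs (picard k.+1 h l - picard k h l) <= majorant k.
  by apply: poly_le_cabs (picard_step_le k) _ _; exact: ltW.
(* One argument for [Re] and [Im]: both are additive and dominated by the modulus. *)
have cvgf (f : C -> R) : (forall z w, f (z + w) = f z + f w) ->
    (forall z, `|f z| <= cabs z) -> cvgn (fun n => f (picard n h l)).
  move=> fD fle.
  have f0 : f 0 = 0 by apply: (@addrI _ (f 0)); rewrite -fD !addr0.
  have -> : (fun n => f (picard n h l)) =
      series (fun k => f (picard k.+1 h l - picard k h l)).
    apply/funext => n; rewrite /series /= big_mkord -[in LHS]picard_telescope.
    by rewrite (big_morph f fD f0).
  apply: normed_cvg.
  apply: (@nonneg_bounded_series_cvg _ _ ((rho + q) / (1 - q))).
    by move=> k; exact: normr_ge0.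
  move=> n; apply: le_trans (majorant_sum n); apply: ler_sum => k _.
  exact: le_trans (fle _) (step k).
split; apply: cvgf; [exact: ReD|exact: normr_Re_le|exact: ImD|].
exact: normr_Im_le.
Qed.

Lemma picard_lim_le h l : `|h| < r -> `|l| < r -> cabs (picard_lim h l) <= rho.
Proof.
move=> hr lr; have := ccvg_dist (picard_cvg hr lr).
move: (picard_lim h l) => z /(cvgD (cvg_cst rho)); rewrite addr0.
move=> /cvgr_to_ge; apply; near=> n.
rewrite -[z in X in X <= _](subKr (picard n h l)).
apply: le_trans (cabsD _ _) _; rewrite cabs_opp; apply: lerD => //.
by apply: poly_le_cabs (picard_le n) _ _; exact: ltW.
Unshelve. all: by end_near. Qed.

(** Pass to the limit in the recursion. The partial sums share the Lipschitz constant [expR rho] on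
    the ball, so the iterate inside them may be replaced by its limit. *)
Lemma picard_lim_fixed h l : `|h| < r -> `|l| < r ->
  picard_lim h l = tau h l - conjc (E0 * (cexp (picard_lim h l) - 1)).
Proof.
move=> hr lr; have cv := picard_cvg hr lr; set z := picard_lim h l in cv *.
apply: (ccvg_unique (ccvgS cv)) => /=.
apply: ccvgD (ccvg_cst _) (ccvgN (ccvg_conj _)).
apply: ccvgM (ccvg_cst _) (ccvgD _ (ccvg_cst _)).
apply: ccvg_sub (ccvgS (ccvg_exp_sum z)).
have c : cabs (picard n h l - z) * expR rho @[n --> \oo] --> 0.
  rewrite -(mul0r (expR rho)); apply: cvgM; last exact: cvg_cst.
  exact: ccvg_dist.
apply: squeeze_cvgr (cvg_cst 0) c; near=> n; rewrite cabs_ge0 /=.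
apply: cabs_exp_sumB => //; last exact: picard_lim_le.
by apply: poly_le_cabs (picard_le n) _ _; exact: ltW.
Unshelve. all: by end_near. Qed.

Lemma picard_lim_real_analytic U MU (w : C) (g : R * R -> R) p :
  poly_le r U MU ->
  (forall h l, `|h| < r -> `|l| < r ->
    g (p.1 + h, p.2 + l) = Re (U h l + w * picard_lim h l)) ->
  real_analytic_at g p.
Proof.
move=> UM; apply: affine_series_real_analytic UM picard_step_le majorant_sum _.
- exact: r_gt0.
- move=> h l hr lr; apply: eq_ccvg (picard_cvg hr lr) => n.
  by rewrite picard_telescope.
Qed.

End analytic_fixed_point.

Arguments picard_lim : simpl never.

(** * Geometry of the wave map: injectivity, monotonicity and level sets *)

Section wave_map.
Variables (R : realType) (k : R).
Hypothesis k_gt0 : 0 < k.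
Local Notation C := R[i].
Implicit Types (p q : R * R) (a b x : R).

(* [Phi k c m t] in the frames moving with speed [m] (labels) and [c]
   (positions). *)
Definition wave p : R * R :=
  (p.1 - expR (k * p.2) / k * sin (k * p.1),
   p.2 + expR (k * p.2) / k * cos (k * p.1)).

Lemma Phi_fst c m t p :
  (Phi k c m t p).1 = (wave (p.1 - m * t, p.2)).1 + c * t.
Proof. by rewrite /Phi /X /wave /=; ring. Qed.

Lemma Phi_snd c m t p : (Phi k c m t p).2 = (wave (p.1 - m * t, p.2)).2.
Proof. by []. Qed.

Lemma wave_contraction p q : p.2 <= 0 -> q.2 <= 0 -> p != q ->
  (((wave p).1 - p.1) - ((wave q).1 - q.1)) ^+ 2 +
  (((wave p).2 - p.2) - ((wave q).2 - q.2)) ^+ 2 <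
  (p.1 - q.1) ^+ 2 + (p.2 - q.2) ^+ 2.
Proof.
case: p q => [a b] [a' b'] /= b_le0 b'_le0 pq.
have kneq0 : k != 0 by rewrite gt_eqF.
have npq : (k * a, k * b) != (k * a', k * b').
  apply: contra pq => /eqP[/(mulfI kneq0) -> /(mulfI kneq0) ->].
  exact: eqxx.
have y_le0 : k * b <= 0 by rewrite pmulr_rle0.
have y'_le0 : k * b' <= 0 by rewrite pmulr_rle0.
have := expi_contraction y_le0 y'_le0 npq.
have k2 : 0 < k ^+ 2 by rewrite exprn_gt0.
move=> H; rewrite -(ltr_pM2l k2).
have -> : k ^+ 2 * ((a - a') ^+ 2 + (b - b') ^+ 2) =
  (k * a - k * a') ^+ 2 + (k * b - k * b') ^+ 2 by ring.
by apply: le_lt_trans H; rewrite le_eqVlt; apply/orP; left; apply/eqP; field.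
Qed.

(** If the images agree, the displacements differ by exactly as much as the labels, against strict
    contraction. *)
Lemma wave_inj p q : p.2 <= 0 -> q.2 <= 0 -> wave p = wave q -> p = q.
Proof.
move=> p0 q0 pq; apply/eqP; apply: contraT => /(wave_contraction p0 q0).
rewrite pq => H; suff : (p.1 - q.1) ^+ 2 + (p.2 - q.2) ^+ 2 <
  (p.1 - q.1) ^+ 2 + (p.2 - q.2) ^+ 2 by rewrite ltxx.
apply: le_lt_trans H; rewrite le_eqVlt; apply/orP; left; apply/eqP.
by move: (wave q) => w; ring.
Qed.

Lemma wave_fst_lt b a a' : b <= 0 -> a < a' ->
  (wave (a, b)).1 < (wave (a', b)).1.
Proof.
move=> b0 aa'.
have /(@wave_contraction (a, b) (a', b) b0 b0) : (a, b) != (a', b).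
  by apply: contraTneq aa' => -[->]; rewrite ltxx.
move: (wave (a, b)) (wave (a', b)) => [A B] [A' B'] /= H.
have {}H : (A - A' - (a - a')) ^+ 2 < (a - a') ^+ 2.
  rewrite subrr expr0n addr0 in H.
  have -> : (A - A' - (a - a')) ^+ 2 = (A - a - (A' - a')) ^+ 2 by ring.
  by apply: le_lt_trans H; rewrite lerDl sqr_ge0.
by rewrite ltNge; apply/negP => A'A; nra.
Qed.

(** With equal abscissae the horizontal terms of the contraction cancel, leaving
    [(u - v) ^+ 2 < v ^+ 2] for the differences [u] of heights and [v] of labels. This yields both
    the common sign of [u] and [v] and the Lipschitz constant 2. *)
Lemma wave_snd_slope p q : p.2 <= 0 -> q.2 <= 0 -> p != q ->
  (wave p).1 = (wave q).1 ->
  ((wave p).2 - (wave q).2) ^+ 2 < 2 * ((wave p).2 - (wave q).2) * (p.2 - q.2).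
Proof.
move=> p0 q0 pq Xpq; have := wave_contraction p0 q0 pq; rewrite Xpq.
move: (wave q) (wave p) => [A B'] [_ B] /= H.
have {}H : (B - B' - (p.2 - q.2)) ^+ 2 < (p.2 - q.2) ^+ 2.
  rewrite -(ltrD2l ((p.1 - q.1) ^+ 2)); apply: le_lt_trans H.
  by rewrite le_eqVlt; apply/orP; left; apply/eqP; ring.
move: H; rewrite sqrrB; set x := (p.2 - q.2) ^+ 2; set y := (B - B') ^+ 2.
by rewrite mulr2n => H; lra.
Qed.

Lemma wave_snd_lt p q : p.2 <= 0 -> q.2 <= 0 -> (wave p).1 = (wave q).1 ->
  p.2 < q.2 -> (wave p).2 < (wave q).2.
Proof.
move=> p0 q0 Xpq pq; have npq : p != q.
  by apply: contraTneq pq => ->; rewrite ltxx.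
have := wave_snd_slope p0 q0 npq Xpq.
rewrite -subr_lt0 -[_ < (wave q).2]subr_lt0 in pq *.
move: ((wave p).2 - _) (p.2 - _) pq => u v v0 H.
have := sqr_ge0 u; rewrite ltNge; have [u0|//] := leP 0 u; nra.
Qed.

Lemma wave_snd_lipschitz p q :
  p.2 <= 0 -> q.2 <= 0 -> (wave p).1 = (wave q).1 ->
  `|(wave p).2 - (wave q).2| <= 2 * `|p.2 - q.2|.
Proof.
move=> p0 q0 Xpq; have [->|pq] := eqVneq p q.
  by rewrite !subrr normr0 mulr0.
have := wave_snd_slope p0 q0 pq Xpq.
move: ((wave p).2 - _) (p.2 - _) => u v H.
have {}H : `|u| * `|u| <= (2 * `|v|) * `|u|.
  rewrite -expr2 real_normK ?num_real//; apply: le_trans (ltW H) _.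
  rewrite -mulrA -mulrA [X in _ <= 2 * X]mulrC -normrM ler_pM2l//.
  exact: ler_norm.
have [->|u0] := eqVneq u 0; first by rewrite normr0 mulr_ge0.
by move: H; rewrite ler_pM2r// normr_gt0.
Qed.

Lemma wave_fst_continuous b : continuous (fun a => (wave (a, b)).1).
Proof.
rewrite /wave /= => a; apply: cvgB; first exact: cvg_id.
apply: cvgM; first exact: cvg_cst.
apply: (@continuous_comp _ _ _ (fun x => k * x) sin).
  by apply: cvgM; [exact: cvg_cst|exact: cvg_id].
exact: continuous_sin.
Qed.

(** The horizontal displacement is at most [A], so the intermediate value theorem applies on
    [[x - A, x + A]]. *)
Lemma wave_fst_surj b x : exists a, (wave (a, b)).1 = x.
Proof.
pose A := expR (k * b) / k.
have A0 : 0 <= A by rewrite divr_ge0 ?expR_ge0// ltW.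
have sA a : - A <= A * sin (k * a) <= A.
  by rewrite -ler_norml normrM (ger0_norm A0) ler_piMr// sin_max.
have [|||a _ <-] := @IVT R (fun a => (wave (a, b)).1) (x - A) (x + A) x.
- by rewrite lerD2l (le_trans _ A0)// oppr_le0.
- by apply: continuous_subspaceT; exact: wave_fst_continuous.
- rewrite ge_min le_max /= -/A.
  have /andP[+ _] := sA (x - A); have /andP[_ +] := sA (x + A).
  move: (sin _) (sin _) => s s' H H'.
  by apply/andP; split; apply/orP; [left|right]; lra.
- by exists a.
Qed.

Lemma wave_snd_le p : p.2 <= 0 -> (wave p).2 <= p.2 + k^-1.
Proof.
move=> p0; rewrite /= lerD2l -[leRHS]mul1r mulrAC; apply: ler_wpM2r.
  by rewrite invr_ge0 ltW.
apply: le_trans (ler_norm _) _; rewrite normrM ger0_norm ?expR_ge0//.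
by rewrite mulr_ile1 ?expR_ge0// ?cos_max// expR_le1 pmulr_rle0.
Qed.

End wave_map.

(** * The surface profile and the region below it *)

Section wave_profile.
Variables (R : realType) (k b0 : R).
Hypotheses (k_gt0 : 0 < k) (b0_le0 : b0 <= 0).
Implicit Types (p q : R * R) (a b x u z : R).

(** Intermediate value theorem for the height along the level set of abscissa [x], parametrized by
    [b]. *)
Lemma wave_below x z a : (wave k (a, b0)).1 = x -> z < (wave k (a, b0)).2 ->
  exists2 p, p.2 < b0 & wave k p = (x, z).
Proof.
move=> ax za; have /choice[xi xiE] b : exists a', (wave k (a', b)).1 = x.
  exact: wave_fst_surj.
have aE : xi b0 = a.
  have [//|] := eqVneq (xi b0) a; rewrite neq_lt.
  move=> /orP[|] /(wave_fst_lt k_gt0 b0_le0);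
  by rewrite xiE ax ltxx.
(* Clamping at [b0] extends the height to a Lipschitz function on the whole line. *)
pose zeta b := (wave k (xi (Num.min b b0), Num.min b b0)).2.
have min_le0 b : Num.min b b0 <= 0 by rewrite ge_min b0_le0 orbT.
have zeta_lip b b' : `|zeta b - zeta b'| <= 2 * `|b - b'|.
  apply: le_trans (wave_snd_lipschitz k_gt0 _ _ _) _ => //=.
    have := xiE (Num.min b b0); have := xiE (Num.min b' b0).
    by rewrite /= => -> ->.
  rewrite ler_pM2l//; case: (leP b b0) (leP b' b0) => [bb|bb] [bb'|bb'] //.
  - by rewrite !ler0_norm; lra.
  - by rewrite !ger0_norm; lra.
  - by rewrite subrr normr0.
have zeta_cont : continuous zeta.
  move=> b; apply/cvgrPdist_le => e e0.
  have e2 : 0 < e / 2 by rewrite divr_gt0.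
  near=> b'; apply: le_trans (zeta_lip b b') _.
  by rewrite mulrC -ler_pdivlMr.
(* A label this deep stays at or below height [z], since the rise is at most [k^-1]. *)
pose b1 := Num.min b0 (z - k^-1).
have b1b0 : b1 <= b0 by rewrite ge_min lexx.
have zeta1 : zeta b1 <= z.
  rewrite /zeta (min_idPl b1b0); apply: le_trans (wave_snd_le k_gt0 _) _ => /=.
    exact: le_trans b1b0 b0_le0.
  by rewrite -lerBrDr ge_min lexx orbT.
have zeta0 : z < zeta b0 by rewrite /zeta minxx aE.
have [|||b /[!in_itv]/= /andP[_ bb0] bz] := @IVT R zeta b1 b0 z.
- exact: b1b0.
- exact: continuous_subspaceT zeta_cont.
- by rewrite ge_min le_max zeta1 (ltW zeta0) orbT.
have {}bb0 : b < b0.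
  rewrite lt_neqAle bb0 andbT; apply: contraTneq zeta0 => <-.
  by rewrite bz ltxx.
exists (xi b, b) => //; rewrite [LHS]surjective_pairing xiE.
by rewrite -bz /zeta (min_idPl (ltW bb0)).
Unshelve. all: by end_near. Qed.

(** Label of the surface particle at abscissa [u], whatever its height; it exists by
    [wave_fst_surj]. *)
Definition crest u : R := xget 0 [set a | (wave k (a, b0)).1 = u].

Definition profile u : R := (wave k (crest u, b0)).2.

Lemma crestE u : (wave k (crest u, b0)).1 = u.
Proof.
have [a au] := wave_fst_surj k_gt0 b0 u.
by apply: (@xgetPex _ 0 [set a | (wave k (a, b0)).1 = u]); exists a.
Qed.

Lemma wave_fst_inj a a' : (wave k (a, b0)).1 = (wave k (a', b0)).1 -> a = a'.
Proof.
move=> aa'; apply/eqP; apply: contraT; rewrite neq_lt => /orP[|].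
all: by move=> /(wave_fst_lt k_gt0 b0_le0); rewrite aa' ltxx.
Qed.

Lemma crest_wave a : crest (wave k (a, b0)).1 = a.
Proof. by apply: wave_fst_inj; rewrite crestE. Qed.

Lemma profile_wave a : profile (wave k (a, b0)).1 = (wave k (a, b0)).2.
Proof. by rewrite /profile crest_wave. Qed.

Lemma wave_boundary q : q.2 = profile q.1 -> wave k (crest q.1, b0) = q.
Proof.
by case: q => x z /= zE; rewrite [LHS]surjective_pairing crestE zE.
Qed.

Lemma wave_below_profile q :
  (exists2 p, p.2 < b0 & wave k p = q) <-> q.2 < profile q.1.
Proof.
split=> [[p pb <-]|].
  apply: wave_snd_lt => //; last by rewrite crestE.
  exact: le_trans (ltW pb) b0_le0.
by case: q => x z /= zx; apply: wave_below (crestE x) zx.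
Qed.

(** It inverts a strictly increasing function: near [u], abscissae lie between those of the labels
    [crest u - e] and [crest u + e]. *)
Lemma crest_continuous : continuous crest.
Proof.
move=> u; apply/cvgrPdist_lt => e e0.
have lt_wave a a' : a < a' -> (wave k (a, b0)).1 < (wave k (a', b0)).1.
  exact: wave_fst_lt.
have wave_lt a a' : (wave k (a, b0)).1 < (wave k (a', b0)).1 -> a < a'.
  move=> aa'; rewrite ltNge; apply/negP; rewrite le_eqVlt => /orP[/eqP a'a|].
    by move: aa'; rewrite a'a ltxx.
  by move=> /lt_wave /(lt_trans aa'); rewrite ltxx.
near=> v; rewrite ltr_distlC; apply/andP; split.
- apply: wave_lt; rewrite crestE; near: v; apply: lt_nbhsr.
  by rewrite -[ltRHS]crestE; apply: lt_wave; rewrite ltrBlDr ltrDl.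
- apply: wave_lt; rewrite crestE; near: v; apply: lt_nbhsl.
  by rewrite -[ltLHS]crestE; apply: lt_wave; rewrite ltrDl.
Unshelve. all: by end_near. Qed.

Lemma profile_continuous : continuous profile.
Proof.
rewrite /profile /wave /= => u; apply: cvgD; first exact: cvg_cst.
apply: cvgM; first exact: cvg_cst.
apply: (@continuous_comp _ _ _ (fun v => k * crest v) cos).
  by apply: cvgM; [exact: cvg_cst|exact: crest_continuous].
exact: continuous_cos.
Qed.

Lemma profile_minimal_period : minimal_period profile (2 * pi / k).
Proof.
have k_neq0 : k != 0 by rewrite gt_eqF.
have A_gt0 : 0 < expR (k * b0) / k by rewrite divr_gt0 ?expR_gt0.
split.
- by rewrite !mulr_gt0 ?invr_gt0 ?pi_gt0.
- move=> u; have kT a : k * (a + 2 * pi / k) = k * a + pi *+ 2.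
    by rewrite mulrDr -mulr_natl; congr (_ + _); field.
  have -> : u + 2 * pi / k = (wave k (crest u + 2 * pi / k, b0)).1.
    by rewrite /= kT sinD2pi addrAC -[in LHS](crestE u).
  by rewrite profile_wave /= kT cosD2pi.
(* A period [T] carries the maximum at 0 to [T], so the cosine there is 1, the sine vanishes and
   [crest T = T]. If [k * T < 2 * pi], then [sin (k * T / 2) > 0] contradicts [cos (k * T) = 1]. *)
- move=> T T0 /(_ 0); rewrite add0r.
  have -> : profile 0 = b0 + expR (k * b0) / k.
    have {1}-> : 0 = (wave k (0, b0)).1 by rewrite /= mulr0 sin0 mulr0 subr0.
    by rewrite profile_wave /= mulr0 cos0 mulr1.
  move=> /addrI; rewrite -[RHS]mulr1 => /(mulfI (lt0r_neq0 A_gt0)) /= c1.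
  have := crestE T; rewrite /= cos1sin0 ?c1 ?normr1// mulr0 subr0 => cT.
  move: c1; rewrite cT => c1; rewrite ler_pdivrMr// leNgt; apply/negP => Tpi.
  have : 0 < sin (k * T / 2).
    apply: sin_gt0_pi; rewrite divr_gt0 ?mulr_gt0//=.
    by rewrite ltr_pdivrMr// mulrC [pi * 2]mulrC.
  move: c1; rewrite -{1}[k * T](divfK (_ : 2 != 0))// mulr_natr cos_mulr2n.
  rewrite cos2sin2.
  by move: (sin _) => s; rewrite -mulr_natr => c1 s0; nra.
Qed.

End wave_profile.

(** * Topology of the region below a continuous graph *)

Section hypograph.
Variable R : realType.

Lemma open_hypograph (f : R -> R) : continuous f ->
  open [set p : R * R | p.2 < f p.1].
Proof.
move=> cf; rewrite openE => p /= pf; rewrite /interior /=.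
have c : f q.1 - q.2 @[q --> p] --> f p.1 - p.2.
  apply: cvgB; last exact: cvg_snd.
  by apply: (@continuous_comp _ _ _ fst f); [exact: cvg_fst|exact: cf].
near=> q; rewrite /= -subr_gt0; near: q.
by apply: (cvgr_gt (f p.1 - p.2)) => //; rewrite subr_gt0.
Unshelve. all: by end_near. Qed.

Lemma boundary_hypograph (f : R -> R) : continuous f ->
  boundary [set p : R * R | p.2 < f p.1] = [set p | p.2 = f p.1].
Proof.
move=> cf; rewrite /boundary; have /interior_id -> := open_hypograph cf.
apply/seteqP; split=> [p /= [clp /negP]|p /= pf].
  rewrite -leNgt => fp; apply/eqP; rewrite eq_le fp andbT leNgt.
  apply/negP => pf.
  have nb : nbhs p [set q : R * R | f q.1 < q.2].
    have c : q.2 - f q.1 @[q --> p] --> p.2 - f p.1.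
      apply: cvgB; first exact: cvg_snd.
      by apply: (@continuous_comp _ _ _ fst f); [exact: cvg_fst|exact: cf].
    near=> q; rewrite /= -subr_gt0; near: q.
    by apply: (cvgr_gt (p.2 - f p.1)) => //; rewrite subr_gt0.
  by have [q [/= q1 q2]] := clp _ nb; have := lt_trans q1 q2; rewrite ltxx.
split; last by rewrite pf ltxx.
move=> B /nbhs_ballP[e /= e0 eB]; exists (p.1, p.2 - e / 2); split=> /=.
  by rewrite pf ltrBlDr ltrDl divr_gt0.
apply: eB; split; first exact: ballxx.
rewrite /ball /= opprB addrC subrK gtr0_norm ?divr_gt0//.
by rewrite ltr_pdivrMr// ltr_pMr// ltr1n.
Unshelve. all: by end_near. Qed.

End hypograph.

(** * Analyticity of the wave map and of its local inverse *)

Section wave_analytic.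
Variables (R : realType) (k : R).
Hypothesis k_gt0 : 0 < k.
Local Notation C := R[i].
Implicit Types (p q : R * R) (r d : R).

Lemma cexpD (z w : C) : cexp (z + w) = cexp z * cexp w.
Proof.
case: z w => [a b] [a' b']; rewrite /cexp; apply: eq_complexP => /=.
all: by rewrite expRD ?cosD ?sinD; ring.
Qed.

Lemma cabs_cexp (z : C) : cabs (cexp z) = expR (Re z).
Proof.
rewrite /cexp /cabs /= !exprMn -mulrDr cos2Dsin2 mulr1 sqrtr_sqr.
by rewrite ger0_norm ?expR_ge0.
Qed.

Lemma wave_cexp p : wave k p =
  (p.1 - Im (cexp ((k * p.2) +i* (k * p.1))) / k,
   p.2 + Re (cexp ((k * p.2) +i* (k * p.1))) / k).
Proof. by rewrite /wave /cexp /=; congr pair; ring. Qed.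

(** The vertical increment is the real part, as depth governs the modulus of [cexp]; the form is
    visibly polynomial, as [poly_le] requires. *)
Definition phase h l : C := k%:C * l%:C + (0 +i* k) * h%:C.

Lemma phaseE h l : phase h l = (k * l) +i* (k * h).
Proof. by apply: eq_complexP => /=; ring. Qed.

Lemma phase_le r : 0 <= r -> poly_le r phase (2 * k * r).
Proof.
move=> r0; have := poly_leD (poly_leZ k%:C r0 (poly_le_snd r))
  (poly_leZ (0 +i* k) r0 (poly_le_fst r)).
rewrite cabs_real.
have -> : cabs (0 +i* k) = `|k| by rewrite /cabs /= expr0n add0r sqrtr_sqr.
by rewrite gtr0_norm// -mulrDl -mulr2n mulr_natl.
Qed.

(** Expand [cexp] about [p] by its addition formula. The separate centre [q] allows for the
    translation between fixed and moving labels. *)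
Lemma wave_combination_real_analytic U MU (w : C) (g : R * R -> R) p q :
  poly_le 1 U MU ->
  (forall h l, g (q.1 + h, q.2 + l) =
    Re (U h l + w * cexp ((k * (p.2 + l)) +i* (k * (p.1 + h))))) ->
  real_analytic_at g q.
Proof.
move=> UM gE; pose w' := w * cexp ((k * p.2) +i* (k * p.1)).
have r1 : 0 <= 1 :> R by [].
apply: (@affine_series_real_analytic _ 1 (fun n h l => phase h l ^+ n / n`!%:R)
  (fun n => (2 * k * 1) ^+ n / n`!%:R) (expR (2 * k * 1)) U MU w'
  (fun h l => cexp (phase h l))) => //.
- by move=> n; apply: poly_le_exp_term => //; exact: phase_le.
- by move=> n; apply: exp_sum_le; rewrite !mulr_ge0// ltW.
- by move=> h l _ _; exact: ccvg_exp_sum.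
- move=> h l _ _; rewrite gE /w' -mulrA -cexpD phaseE.
  by congr (Re (_ + _ * cexp _)); apply: eq_complexP => /=; ring.
Qed.

Lemma wave_fst_real_analytic (g : R * R -> R) p q d :
  (forall h l, g (q.1 + h, q.2 + l) = (wave k (p.1 + h, p.2 + l)).1 + d) ->
  real_analytic_at g q.
Proof.
move=> gE; apply: (@wave_combination_real_analytic
  (fun h _ => (p.1 + d)%:C + h%:C) _ (0 +i* k^-1) g p q
  (poly_leD (poly_le_cst _ _) (poly_le_fst _))) => h l.
by rewrite gE /=; ring.
Qed.

Lemma wave_snd_real_analytic (g : R * R -> R) p q d :
  (forall h l, g (q.1 + h, q.2 + l) = (wave k (p.1 + h, p.2 + l)).2 + d) ->
  real_analytic_at g q.
Proof.
move=> gE; apply: (@wave_combination_real_analytic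
  (fun _ l => (p.2 + d)%:C + l%:C) _ k^-1%:C g p q
  (poly_leD (poly_le_cst _ _) (poly_le_snd _))) => h l.
by rewrite gE /=; ring.
Qed.

(** [D] is the increment of the label as a function of that of the position. Analyticity is phrased
    for functions that agree locally with a shift of [D], so that it applies to a global inverse. *)
Lemma wave_local_inverse p (b0 : R) : p.2 < b0 -> b0 <= 0 ->
  exists2 r : R, 0 < r & exists D : R -> R -> R * R,
  [/\ forall h l, `|h| < r -> `|l| < r ->
        p.2 + (D h l).2 < b0 /\
        wave k (p.1 + (D h l).1, p.2 + (D h l).2) =
        ((wave k p).1 + h, (wave k p).2 + l),
      forall (g : R * R -> R) q d,
        (forall h l, `|h| < r -> `|l| < r ->
          g (q.1 + h, q.2 + l) = d + (D h l).1) ->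
        real_analytic_at g q &
      forall (g : R * R -> R) q d,
        (forall h l, `|h| < r -> `|l| < r ->
          g (q.1 + h, q.2 + l) = d + (D h l).2) ->
        real_analytic_at g q].
Proof.
move=> pb b0_le0; have k_neq0 : k != 0 by rewrite gt_eqF.
pose z0 : C := (k * p.2) +i* (k * p.1).
(* Half the scaled distance to the boundary: labels stay below [b0], and the contraction factor is
   [expR (k * (b0 + p.2) / 2) < 1]. *)
pose rho := k * (b0 - p.2) / 2.
have rho_gt0 : 0 < rho by rewrite divr_gt0// mulr_gt0// subr_gt0.
pose E0 := cexp z0.
have q_lt1 : cabs E0 * expR rho < 1.
  rewrite cabs_cexp -expRD expR_lt1 /= /rho.
  have -> : k * p.2 + k * (b0 - p.2) / 2 = k * ((b0 + p.2) / 2) by field.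
  by rewrite pmulr_rlt0//; lra.
(* Chosen so that the bound [2 * k * r] on [phase] is the one the Picard iteration asks for. *)
pose r := (1 - cabs E0 * expR rho) * rho / (2 * k).
have r_gt0 : 0 < r by rewrite divr_gt0 ?mulr_gt0 ?subr_gt0.
have tau_le : poly_le r phase ((1 - cabs E0 * expR rho) * rho).
  have := phase_le (ltW r_gt0); congr (poly_le _ _ _).
  by rewrite /r; field.
pose S := picard_lim E0 phase.
pose D h l := (Im (S h l) / k, Re (S h l) / k).
have D1 h l : (D h l).1 = Im (S h l) / k by [].
have D2 h l : (D h l).2 = Re (S h l) / k by [].
exists r => //; exists D; split.
- move=> h l hr lr; rewrite D1 D2.
  have : S h l = phase h l - conjc (E0 * (cexp (S h l) - 1)).
    exact: (picard_lim_fixed rho_gt0 r_gt0 q_lt1 tau_le).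
  have : cabs (S h l) <= rho.
    exact: (picard_lim_le rho_gt0 r_gt0 q_lt1 tau_le).
  move: (S h l) => s s_le sE.
  split.
    rewrite -ltrBrDl ltr_pdivrMr//.
    have := le_trans (ler_norm _) (le_trans (normr_Re_le s) s_le).
    move=> /le_lt_trans; apply.
    by rewrite /rho ltr_pdivrMr// mulrC ltr_pMr ?ltr1n// mulr_gt0// subr_gt0.
  have zE : (k * (p.2 + Re s / k)) +i* (k * (p.1 + Im s / k)) = z0 + s.
    by apply: eq_complexP; rewrite ?ReD ?ImD /=; field.
  rewrite wave_cexp [wave k p]wave_cexp [(_, _).1]/= [(_, _).2]/= -/z0 zE.
  (* The real and imaginary parts of the fixed-point equation are the two wave equations, scaled by
     [k]. *)
  have [sRe sIm] : Re s = k * l - Re (cexp (z0 + s)) + Re E0 /\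
      Im s = k * h + Im (cexp (z0 + s)) - Im E0.
    move: sE; rewrite mulrBr mulr1 -cexpD phaseE -/E0.
    move: (cexp (z0 + s)) (E0) => [x y] [u v] ->.
    by split=> /=; ring.
  move: sRe sIm; rewrite -/E0.
  move: (cexp (z0 + s)) (E0) => [x y] [u v] /= -> ->.
  by congr pair; field.
- move=> g q d gE.
  apply: (picard_lim_real_analytic rho_gt0 r_gt0 q_lt1 tau_le
    (w := 0 +i* - k^-1) (poly_le_cst r d%:C)) => h l hr lr.
  by rewrite gE// -/S D1; case: (S h l) => x y /=; ring.
- move=> g q d gE.
  apply: (picard_lim_real_analytic rho_gt0 r_gt0 q_lt1 tau_le
    (w := k^-1%:C) (poly_le_cst r d%:C)) => h l hr lr.
  by rewrite gE// -/S D2; case: (S h l) => x y /=; ring.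
Qed.

End wave_analytic.

(** * Return from the moving frames to the fixed one *)

Theorem lemma3p1 (R : realType) (k b0 c m : R) (hk : 0 < k) (hb0 : b0 <= 0) :
  (forall t : R, 0 <= t ->
     real_analytic_diffeo (Sigma b0) (Omega k b0 c m t) (Phi k c m t)) /\
  (exists2 eta : R -> R, minimal_period eta (2 * pi / k) &
     forall t : R, 0 <= t ->
       Omega k b0 c m t = [set p : R * R | p.2 < eta (p.1 - c * t)] /\
       set_bij (boundary (Sigma b0)) (boundary (Omega k b0 c m t))
         (Phi k c m t)).
Proof.
have OmegaE t : Omega k b0 c m t =
    [set p : R * R | p.2 < profile k b0 (p.1 - c * t)].
  apply/seteqP; split=> [_ [p pb <-]|q qt].
    rewrite /mkset Phi_fst Phi_snd addrK.
    by apply: (wave_below_profile hk hb0 _).1; exists (p.1 - m * t, p.2).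
  have [p pb pq] := (wave_below_profile hk hb0 (q.1 - c * t, q.2)).2 qt.
  exists (p.1 + m * t, p.2) => //; rewrite [LHS]surjective_pairing.
  rewrite Phi_fst Phi_snd addrK -surjective_pairing pq subrK.
  by rewrite -surjective_pairing.
have Phi_inj t p q : p.2 <= b0 -> q.2 <= b0 ->
    Phi k c m t p = Phi k c m t q -> p = q.
  move=> pb qb pq; have : wave k (p.1 - m * t, p.2) = wave k (q.1 - m * t, q.2).
    rewrite [LHS]surjective_pairing [RHS]surjective_pairing -!(Phi_snd k c) pq.
    by congr pair; apply: (@addIr _ (c * t)); rewrite -!Phi_fst pq.
  have p_le0 := le_trans pb hb0; have q_le0 := le_trans qb hb0.
  move=> /(@wave_inj _ _ hk (_, _) (_, _) p_le0 q_le0) [/addIr p1 p2].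
  by rewrite [p]surjective_pairing p1 p2 -surjective_pairing.
have eta_cont t : continuous (fun u => profile k b0 (u - c * t)).
  move=> u; apply: (@continuous_comp _ _ _ (fun u => u - c * t) (profile k b0)).
    by apply: cvgB; [exact: cvg_id|exact: cvg_cst].
  exact: profile_continuous.
(* The domain is the hypograph of a constant, so one lemma gives both boundaries as graphs. *)
have SigmaE : Sigma b0 = [set p : R * R | p.2 < b0] by [].
have cst_cont : continuous (fun _ : R => b0) by move=> u; exact: cvg_cst.
split=> [t _|]; last first.
  exists (profile k b0) => [|t _]; first exact: profile_minimal_period.
  split=> //; rewrite OmegaE (boundary_hypograph (eta_cont t)).
  rewrite SigmaE (boundary_hypograph cst_cont).
  split.
  - move=> p pb; rewrite /mkset Phi_fst Phi_snd addrK (pb : p.2 = b0).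
    by rewrite profile_wave.
  - move=> p q /set_mem pb /set_mem qb.
    by apply: Phi_inj; [rewrite (pb : p.2 = b0)|rewrite (qb : q.2 = b0)].
  - move=> q qt.
    exists (crest k b0 (q.1 - c * t) + m * t, b0) => //.
    rewrite [LHS]surjective_pairing Phi_fst Phi_snd addrK.
    rewrite (@wave_boundary _ _ _ hk (q.1 - c * t, q.2) qt) subrK.
    by rewrite -surjective_pairing.
(* The global inverse by choice, with default [(0, 0)] outside the image. *)
pose G q := xget (0, 0) [set p | Sigma b0 p /\ Phi k c m t p = q].
have GP p : Sigma b0 p -> G (Phi k c m t p) = p.
  move=> pb; pose q := Phi k c m t p.
  have [Gb Gp] : [set p' | Sigma b0 p' /\ Phi k c m t p' = q] (G q).
    by apply: (@xgetPex _ (0, 0)); exists p.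
  by apply: (Phi_inj t) Gp; exact: ltW.
split.
- exact: open_hypograph cst_cont.
- by rewrite OmegaE; exact: open_hypograph (eta_cont t).
- split => //; first by move=> p pb; exists p.
  by move=> p q /set_mem pb /set_mem qb; apply: Phi_inj; exact: ltW.
- move=> p _; split.
  + apply: (@wave_fst_real_analytic _ _ hk _ (p.1 - m * t, p.2) p (c * t)).
    move=> h l.
    by rewrite Phi_fst (addrAC p.1).
  + apply: (@wave_snd_real_analytic _ _ hk _ (p.1 - m * t, p.2) p 0) => h l.
    by rewrite Phi_snd (addrAC p.1) addr0.
- exists G => // _ [p pb <-].
  have [r r0 [D [DE D1 D2]]] :=
    @wave_local_inverse _ _ hk (p.1 - m * t, p.2) b0 pb hb0.
  (* The local inverse stays in [Sigma b0], where [G] is a left inverse of [Phi], so the two agree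
     near the image of [p]. *)
  have GE h l : `|h| < r -> `|l| < r ->
      G ((Phi k c m t p).1 + h, (Phi k c m t p).2 + l) =
      (p.1 + (D h l).1, p.2 + (D h l).2).
    move=> hr lr; have [Db Dw] := DE h l hr lr.
    rewrite -[RHS]GP//; congr G; rewrite [RHS]surjective_pairing.
    by rewrite !Phi_fst !Phi_snd addrAC [_ + _ - m * t]addrAC Dw.
  split.
  + by apply: (D1 _ _ p.1) => h l hr lr; rewrite GE.
  + by apply: (D2 _ _ p.2) => h l hr lr; rewrite GE.
Qed.
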